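(* Let $a,b,c,v$ be real constants with $a>0$ and $v>0$. The solutions $\omega=\omega(t,s)$ ($t>0$, $s>0$) of the initial value problem $$\omega_t+s\,(a t^{2v-1}s-b)\,\omega_s=-c\,s\,\omega+f(t),\qquad \lim_{t\to0}\omega(t,s)=\pi(s),$$ are given by $$\omega(t,s)=e^{-G(t;K(t,s))+G^{\star}(0;K(t,s))}\;\pi\!\left(\frac{s e^{bt}}{1-s e^{bt}\,a b^{-2v}\,(\Gamma(2v,bt)-\Gamma(2v))}\right)+e^{-G(t;K(t,s))}\int_0^t f(\tau)\,e^{G(\tau;K(t,s))}\,d\tau ,$$ where $$K(t,s)=\frac{1-s\,a b^{-2v}\,\Gamma(2v,bt)\,e^{bt}}{s e^{bt}} .$$
   Context: $\Gamma(q,p)=\int_p^\infty x^{q-1}e^{-x}\,dx$ is the upper incomplete gamma function and $\Gamma(q)=\Gamma(q,0)$ is the usual gamma function. For a parameter $\mathcal C$, $G(\mu;\mathcal C)$ denotes the indefinite integral with respect to $\mu$, with the constant of integration omitted, of $$\mu\mapsto\frac{c}{a b^{-2v}\,\Gamma(2v,b\mu)\,e^{b\mu}+e^{b\mu}\,\mathcal C},$$ and $G^{\star}(\nu;\mathcal C)$ is the value of the same antiderivative at $\mu=\nu$; the formula involves only differences of values of this antiderivative. In $G(\tau;K(t,s))$ the parameter $K(t,s)$ is held fixed while $\tau$ varies. The quantities $b^{-2v}\Gamma(2v,\cdot)$ enter only through differences, and for $b\le 0$ these are read via $b^{-2v}(\Gamma(2v,b\mu)-\Gamma(2v,bt))=\int_\mu^t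 r^{2v-1}e^{-br}\,dr$. Here $\pi(s)=\int_0^\infty e^{-sx}\,dP(x)$ is the Laplace transform (assumed to exist) of a function $P$ of bounded variation on $(0,\infty)$ with $P(x)\to0$ as $x\to0$. The function $f$ is a function of $t$ bounded in every finite $t$-interval. It arises as the flux at the origin, $f(t)=-\lim_{x\to0}\{(a t^{2v-1}x u)_x-(bx+c)u\}$, of a solution $u$ of $u_t=(a t^{2v-1}xu)_{xx}-((bx+c)u)_x$, $0<x<\infty$, and $\omega(t,s)=\int_0^\infty e^{-sx}u(t,x)\,dx$. *)

(* Defs.v *)
From HB Require Import structures.
From mathcomp Require Export all_boot all_order all_algebra.
From mathcomp Require Export all_classical all_reals all_analysis.
Export Order.TTheory GRing.Theory Num.Theory.
Export numFieldNormedType.Exports.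

Set Implicit Arguments.
Unset Strict Implicit.
Unset Printing Implicit Defensive.

Local Open Scope classical_set_scope.
Local Open Scope ring_scope.

Section definitions.
Context {R : realType}.
Implicit Types (a b c v q p mu t s k x y : R) (P f lap : R -> R)
  (G omega : R -> R -> R).

Definition RS_sum (g P : R -> R) x (l : seq R) (xi : nat -> R) : R :=
  \sum_(i < size l) g (xi i) * (P (nth x l i) - P (nth x (x :: l) i)).

(* J is the Riemann-Stieltjes integral of g dP over [x, y]; no one-sided
   continuity of P is required, and the tags are arbitrary. *)
Definition is_RS_integral (g P : R -> R) x y (J : R) : Prop :=
  forall e : R, 0 < e -> exists2 d : R, 0 < d &
    forall (l : seq R) (xi : nat -> R), itv_partition x y l ->
      (forall i, (i < size l)%N ->
         nth x (x :: l) i <= xi i <= nth x l i /\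
         nth x l i - nth x (x :: l) i < d) ->
      `|RS_sum g P x l xi - J| < e.

(* L is the improper integral of e^(-s x) dP(x) over (0, oo), that is the
   joint limit of the integrals over [x, y] as x -> 0+ and y -> +oo. *)
Definition is_laplace_stieltjes P s (L : R) : Prop :=
  exists2 J : R -> R -> R,
    (forall x y, 0 < x -> x < y ->
       is_RS_integral (fun u => expR (- (s * u))) P x y (J x y)) &
    (forall e : R, 0 < e ->
       \forall x \near 0^'+ & y \near +oo%R, `|J x y - L| < e).

Definition upper_gamma q p : R :=
  \int[lebesgue_measure]_(x in `[p, +oo[) (x `^ (q - 1) * expR (- x)).

(* b^(-2v) Gamma(2v, b mu), for mu >= 0.  When b <= 0 only its differences
   have a meaning, namely
     scaled_gamma mu - scaled_gamma t = \int_mu^t r^(2v-1) e^(-br) dr;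
   the additive constant is then fixed by taking the value 0 at mu = 0. *)
Definition scaled_gamma b v mu : R :=
  if 0 < b then b `^ (- (2 * v)) * upper_gamma (2 * v) (b * mu)
  else - \int[lebesgue_measure]_(r in `[0, mu])
           (r `^ (2 * v - 1) * expR (- (b * r))).

Definition G_integrand a b c v k mu : R :=
  c / (a * scaled_gamma b v mu * expR (b * mu) + expR (b * mu) * k).

Definition K a b v t s : R :=
  (1 - s * a * scaled_gamma b v t * expR (b * t)) / (s * expR (b * t)).

(* H is an antiderivative of h on [0, t], with arbitrary constant of
   integration; at the endpoints only one-sided continuity is required. *)
Definition is_antiderivative t (h H : R -> R) : Prop :=
  {within `[0, t], continuous H} /\
  forall mu, 0 < mu < t -> is_derive mu 1 H (h mu).

Definition omega_formula a b v lap f G t s : R :=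
  let k := K a b v t s in
  expR (- G t k + G 0 k)
    * lap (s * expR (b * t)
           / (1 - s * expR (b * t) * a
                  * (scaled_gamma b v t - scaled_gamma b v 0)))
  + expR (- G t k)
    * \int[lebesgue_measure]_(tau in `[0, t]) (f tau * expR (G tau k)).

(* Differentiability is joint (Frechet) differentiability in (t, s). *)
Definition solves_pde_at a b c v f omega t s : Prop :=
  differentiable (fun z : R * R => omega z.1 z.2) (t, s) /\
  derive1 (omega ^~ s) t
    + s * (a * t `^ (2 * v - 1) * s - b) * derive1 (omega t) s
  = - c * s * omega t s + f t.

Definition initial_condition lap omega : Prop :=
  forall s, 0 < s -> omega t s @[t --> 0^'+] --> lap s.

Definition is_solution a b c v lap f omega : Prop :=
  (forall t s, 0 < t -> 0 < s -> solves_pde_at a b c v f omega t s) /\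
  initial_condition lap omega.

(* For a source f that is merely measurable the equation can only be expected
   to hold for almost every time t (and then for all s). *)
Definition is_solution_ae a b c v lap f omega : Prop :=
  {ae lebesgue_measure, forall t, 0 < t ->
     forall s, 0 < s -> solves_pde_at a b c v f omega t s} /\
  initial_condition lap omega.

Definition locally_bounded f : Prop :=
  forall T : R, exists M : R, forall t, 0 < t <= T -> `|f t| <= M.

End definitions.

(* Main.v *)
Require Import Defs.
From mathcomp Require Import measurable_realfun ring lra.

Set Implicit Arguments.
Unset Strict Implicit.
Unset Printing Implicit Defensive.

Local Open Scope classical_set_scope.
Local Open Scope ring_scope.

(** Put g = scaled_gamma b v, so that g'(t) = - t^(2 v - 1) e^(- b t). Along a
    characteristic of the equation, d s / d t = s (a t^(2 v - 1) s - b), the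
    reciprocal 1 / s solves a linear equation, whose first integral is
    e^(- b t) / s - a g(t). This is K(t, s): a characteristic is the curve
    s = e^(- b t) / (a g(t) + k) with k fixed. On it the equation becomes
    W' = - c s W + f(t), and c s is exactly the integrand of G(. ; k), so
    e^(G(t; k)) W(t) - int_0^t f(tau) e^(G(tau; k)) d tau is constant. The foot
    of the characteristic, at t = 0, is s = 1 / (a g(0) + k); matching the
    constant with the initial value lap there gives the formula. In the
    variables (t, k) it reads (omega_formulaE), for W = evolution,
      W(t, k) = e^(- Phi(t, k)) (lap (1 / (a g(0) + k)) + Psi(t, k)),
    where Phi(t, k) = G(t; k) - G(0; k) is damping and
    Psi(t, k) = int_0^t f e^(Phi(., k)) is forcing.

    That the formula is a solution requires joint differentiability in (t, s).
    Differentiability of lap is not immediate, because the Stieltjes integral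
    may converge only conditionally. Integration by parts (RS_integral_by_parts)
    and a Gronwall argument show P(u) = O(e^(d u)) for every d > 0, whence
    lap s = s int_0^oo e^(- s u) P(u) du with absolute convergence, and one
    differentiates under the integral sign (laplace_derivable).
    Differentiability of Phi and Psi rests on expansions of the integrands to
    second order in k, uniform in the time variable (expands_at), a notion
    stable under integration against f and under exp
    (expands_at_integral, expands_at_expR, differentiable_expansion). The source
    enters only through the differentiability of t |-> int_0^t f, a condition
    free of s: at every t if f is continuous, and at almost every t, by
    Lebesgue's theorem, if f is measurable. Once the differentiability is known,
    the equation is the chain rule along a characteristic
    (is_derive_along, omega_formula_solves_pde).

    For uniqueness, an arbitrary solution w is restricted to a characteristic.
    There f e^Phi is the derivative of e^Phi w, and it is bounded on bounded time
    intervals. It is measurable, because the equation exhibits f as a limit of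
    measurable functions (solution_source_measurable), so its integral is the
    increment of e^Phi w (FTC_bounded_derivative): e^Phi w - Psi is a constant
    phi(k). The initial condition speaks of vertical lines s = constant only, not
    of characteristics. But phi is continuous, because it can be computed at a
    fixed positive time, where w is differentiable; and along a vertical line
    K(t, s) converges as t -> 0. Hence phi(k) is the value of lap at the foot of
    the characteristic k. *)

(** * Bounded measurable functions on a segment *)

Section bounded_measurable.
Context {R : realType}.
Notation mu := (@lebesgue_measure R).
Implicit Types (a b c M : R) (f g : R -> R).

Definition bounded_mfun a b f : Prop :=
  measurable_fun `[a, b] f /\
  exists M, forall x, a <= x <= b -> `|f x| <= M.

Let itv_mu_lty a b : (mu `[a, b] < +oo)%E.
Proof. by rewrite lebesgue_measure_itv/=; case: ifPn => _; rewrite ?ltry// -EFinB ltry. Qed.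

Let fine_mu_itv a b : a <= b -> fine (mu `[a, b]) = b - a.
Proof.
rewrite lebesgue_measure_itv/= lte_fin; case: ltP => [_ _|ba ab]; first by rewrite -EFinB.
have -> : a = b by apply/eqP; rewrite eq_le ab ba.
by rewrite subrr.
Qed.

Lemma bounded_mfun_integrable a b f :
  bounded_mfun a b f -> mu.-integrable `[a, b] (EFin \o f).
Proof.
move=> [mf [M fM]]; apply: measurable_bounded_integrable => //.
  exact: itv_mu_lty.
exists M; split; first exact: num_real.
move=> N MN x /=; rewrite in_itv/= => xab.
by rewrite (le_trans (fM x xab))// ltW.
Qed.

Lemma continuous_bounded_mfun a b f :
  {within `[a, b], continuous f} -> bounded_mfun a b f.
Proof.
move=> cf; split.
  exact: subspace_continuous_measurable_fun.
have [ab|ba] := leP a b; last first.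
  by exists 0 => x /andP[ax xb]; have := le_trans ax xb; rewrite leNgt ba.
have cnf : {within `[a, b], continuous (fun x => `|f x|)}.
  by move=> x; apply: cvg_norm; exact: cf.
have [c _ cmax] := EVT_max ab cnf.
by exists `|f c| => x xab; apply: cmax; rewrite in_itv.
Qed.

Lemma bounded_mfunM a b f g : bounded_mfun a b f -> bounded_mfun a b g ->
  bounded_mfun a b (fun x => f x * g x).
Proof.
move=> [mf [M fM]] [mg [N gN]]; split; first exact: measurable_funM.
exists (M * N) => x xab; rewrite normrM ler_pM//; [exact: fM|exact: gN].
Qed.

Lemma bounded_mfunB a b f g : bounded_mfun a b f -> bounded_mfun a b g ->
  bounded_mfun a b (fun x => f x - g x).
Proof.
move=> [mf [M fM]] [mg [N gN]]; split; first exact: measurable_funB.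
exists (M + N) => x xab; rewrite (le_trans (ler_normB _ _))// lerD//.
- exact: fM.
- exact: gN.
Qed.

Lemma bounded_mfun_cst a b c : bounded_mfun a b (fun=> c).
Proof. by split; [exact: measurable_cst|exists `|c|]. Qed.

Lemma bounded_mfunS a b c d f : a <= c -> d <= b ->
  bounded_mfun a b f -> bounded_mfun c d f.
Proof.
move=> ac db [mf [M fM]]; split.
  apply: measurable_funS mf => //.
  by apply: subset_itvScc; rewrite bnd_simp.
by exists M => x /andP[cx xd]; apply: fM; rewrite (le_trans ac cx) (le_trans xd db).
Qed.

Lemma norm_Rintegral_le a b f M : a <= b -> bounded_mfun a b f ->
  (forall x, a <= x <= b -> `|f x| <= M) ->
  `|\int[mu]_(x in `[a, b]) f x| <= M * (b - a).
Proof.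
move=> ab bf fM.
apply: le_trans.
  apply: le_normr_Rintegral => //; exact: bounded_mfun_integrable.
apply: le_trans.
  apply: (@le_Rintegral _ _ _ mu _ _ (fun=> M)) => //=.
  - apply: (bounded_mfun_integrable (f := fun x => `|f x|)).
    case: bf => mf _; split; first exact: measurableT_comp.
    by exists M => x xab; rewrite normr_id fM.
  - exact: (bounded_mfun_integrable (bounded_mfun_cst a b M)).
rewrite Rintegral_cst//.
have Eab := fine_mu_itv ab.
by rewrite [X in _ * X]Eab.
Qed.

Lemma Rintegral_split a b c f : a <= b -> b <= c -> bounded_mfun a c f ->
  \int[mu]_(x in `[a, c]) f x =
  \int[mu]_(x in `[a, b]) f x + \int[mu]_(x in `[b, c]) f x.
Proof.
move=> ab bc bf.
have := @Rintegral_itvB R f (BLeft a) (BRight c) b.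
move=> /(_ (bounded_mfun_integrable bf)); rewrite !bnd_simp => /(_ ab bc).
rewrite Rintegral_itv_obnd_cbnd => [<-|]; first by rewrite addrC subrK.
apply: (@integrableS _ _ _ mu `[b, c]) => //.
  by apply: subset_itvr; rewrite bnd_simp.
by apply: bounded_mfun_integrable; apply: bounded_mfunS bf.
Qed.

End bounded_measurable.

(** * Second-order expansions in a parameter *)
Section expansion.
Context {R : realType}.
Notation mu := (@lebesgue_measure R).
Implicit Types (T k t x : R) (f p q : R -> R).

(** The remainder is bounded uniformly in the variable x, so that the notion
    passes through integrals in x. *)
Definition expands_at T (e : R -> R -> R) k0 (e' : R -> R) : Prop :=
  {within `[0, T], continuous e'} /\
  exists C, exists2 d, 0 < d & forall k, `|k - k0| < d ->
    {within `[0, T], continuous (e ^~ k)} /\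
    forall x, 0 <= x <= T ->
      `|e x k - e x k0 - (k - k0) * e' x| <= C * (k - k0) ^+ 2.

Lemma expands_at_continuous T e k0 e' :
  expands_at T e k0 e' -> {within `[0, T], continuous (e ^~ k0)}.
Proof.
by move=> [_ [C [d d0 /(_ k0)]]]; rewrite subrr normr0 => /(_ d0)[].
Qed.

(** The remainder of the integral is the integral of the remainder. *)
Lemma expands_at_integral T f e k0 e' : 0 <= T -> bounded_mfun 0 T f ->
  expands_at T e k0 e' ->
  expands_at T (fun t k => \int[mu]_(x in `[0, t]) (f x * e x k)) k0
    (fun t => \int[mu]_(x in `[0, t]) (f x * e' x)).
Proof.
move=> T0 bf ee'; have [ce' [C [d d0 H]]] := ee'.
have ce0 := expands_at_continuous ee'.
have bfe q : {within `[0, T], continuous q} ->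
    bounded_mfun 0 T (fun x => f x * q x).
  by move=> cq; apply: bounded_mfunM => //; exact: continuous_bounded_mfun.
have cint q : {within `[0, T], continuous q} ->
    {within `[0, T], continuous (fun t => \int[mu]_(x in `[0, t]) (f x * q x))}.
  move=> cq; apply: parameterized_integral_continuous => //.
  by apply: bounded_mfun_integrable; exact: bfe.
split; first exact: cint.
have [mf [M fM]] := bf.
exists (M * C * T), d => // k kd; have [cek Hk] := H k kd; split; first exact: cint.
move=> x /andP[x0 xT].
have sb q : {within `[0, T], continuous q} -> bounded_mfun 0 x (fun x => f x * q x).
  by move=> cq; apply: bounded_mfunS (bfe _ cq).
have si q (cq : {within `[0, T], continuous q}) := bounded_mfun_integrable (sb _ cq).
rewrite -RintegralB//=; [|exact: si|exact: si].
rewrite -RintegralZl//=; last exact: si.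
have sB : bounded_mfun 0 x (fun y => f y * e y k - f y * e y k0).
  by apply: bounded_mfunB; exact: sb.
have sZ : bounded_mfun 0 x (fun y => (k - k0) * (f y * e' y)).
  by apply: bounded_mfunM; [exact: bounded_mfun_cst|exact: sb].
rewrite -RintegralB//=; [|exact: bounded_mfun_integrable|exact: bounded_mfun_integrable].
have M0 : 0 <= M by rewrite (le_trans _ (fM 0 _))// lexx.
have C0 : 0 <= C * (k - k0) ^+ 2.
  by rewrite (le_trans _ (Hk 0 _))// lexx.
apply: (@le_trans _ _ (M * (C * (k - k0) ^+ 2) * (x - 0))).
  apply: norm_Rintegral_le => //; first exact: bounded_mfunB.
  move=> y /andP[y0 yx]; have yT : 0 <= y <= T by rewrite y0 (le_trans yx).
  rewrite (_ : _ - _ = f y * (e y k - e y k0 - (k - k0) * e' y)); last by ring.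
  by rewrite normrM ler_pM// ?fM ?Hk.
rewrite subr0 (_ : _ * C * T * _ = M * (C * (k - k0) ^+ 2) * T); last by ring.
by rewrite ler_wpM2l// mulr_ge0.
Qed.

(** For y <= 1/2 the upper bound follows from e^(- y) >= 1 - y, that is
    e^y <= 1 / (1 - y) <= 1 + y + 2 y^2. *)
Let expR_quadratic (y : R) : `|y| <= 2^-1 -> `|expR y - 1 - y| <= 2 * y ^+ 2.
Proof.
rewrite ler_norml => /andP[y1 y2].
have h1 := expR_ge1Dx y; have h2 := expR_ge1Dx (- y).
have h3 : expR y * expR (- y) = 1 by rewrite -expRD subrr expR0.
have e0 := expR_gt0 y.
have h4 : expR y * (1 - y) <= 1 by rewrite -[leRHS]h3 ler_pM2l.
rewrite ger0_norm; last by lra.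
have y1' : 0 < 1 - y by lra.
rewrite -(ler_pM2r y1').
suff : expR y * (1 - y) <= (1 + y + 2 * y ^+ 2) * (1 - y) by lra.
apply: (le_trans h4).
rewrite (_ : _ * (1 - y) = 1 + y ^+ 2 * (1 - 2 * y)); last by ring.
by rewrite lerDl mulr_ge0// ?sqr_ge0//; lra.
Qed.

Lemma expands_at_expR T e k0 e' : 0 <= T -> expands_at T e k0 e' ->
  expands_at T (fun x k => expR (e x k)) k0 (fun x => expR (e x k0) * e' x).
Proof.
move=> T0 ee'; have [ce' [C [d d0 H]]] := ee'.
have ce0 := expands_at_continuous ee'.
have cexp q : {within `[0, T], continuous q} ->
    {within `[0, T], continuous (fun x => expR (q x))}.
  by move=> cq x; apply: continuous_comp (cq x) _; exact: continuous_expR.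
split; first by move=> x; apply: cvgM; [exact: cexp|exact: ce'].
have [_ [B e'B]] := continuous_bounded_mfun ce'.
have [_ [N eN]] := continuous_bounded_mfun (cexp _ ce0).
have B0 : 0 <= B by rewrite (le_trans _ (e'B 0 _))// lexx.
have N0 : 0 <= N by rewrite (le_trans _ (eN 0 _))// lexx.
pose C' := Num.max C 0.
have C'0 : 0 <= C' by rewrite le_max lexx orbT.
exists (N * (2 * (C' + B) ^+ 2 + C')).
(* This radius keeps the increment of e, at most (C' + B) |k - k0|, below 1/2. *)
exists (Num.min d (2 * (C' + B + 1))^-1).
  by rewrite lt_min d0 invr_gt0; lra.
move=> k; rewrite lt_min => /andP[kd k1]; have [cek Hk] := H k kd.
split; first exact: cexp.
move=> x xT.
set u := e x k0; set y0 := (k - k0) * e' x; set y := e x k - u.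
have -> : e x k = u + y by rewrite /y addrC subrK.
set D := `|k - k0| in kd k1.
have D0 : 0 <= D by exact: normr_ge0.
have DE : (k - k0) ^+ 2 = D ^+ 2 by rewrite real_normK// num_real.
have yy0 : `|y - y0| <= C' * D ^+ 2.
  by rewrite (le_trans (Hk _ xT))// DE ler_wpM2r ?sqr_ge0// le_max lexx.
have D1 : D * (2 * (C' + B + 1)) < 1.
  by rewrite -ltr_pdivlMr ?mul1r//; lra.
have Dle1 : D <= 1 by nra.
have y0B : `|y0| <= D * B by rewrite normrM ler_wpM2l// e'B.
have yD : `|y| <= (C' + B) * D.
  have -> : y = (y - y0) + y0 by rewrite subrK.
  rewrite (le_trans (ler_normD _ _))//.
  have : C' * D ^+ 2 <= C' * D by rewrite ler_wpM2l// expr2 ler_piMr.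
  lra.
have y2 : `|y| <= 2^-1 by nra.
rewrite expRD (_ : _ - _ = expR u * ((expR y - 1 - y) + (y - y0))); last first.
  by rewrite /y0; ring.
rewrite normrM DE -mulrA ler_pM//; first exact: eN.
rewrite (le_trans (ler_normD _ _))// mulrDl lerD//.
rewrite (le_trans (expR_quadratic y2))// -mulrA -exprMn ler_wpM2l//.
by rewrite -[y ^+ 2]real_normK ?num_real// lerXn2r// nnegrE// mulr_ge0// addr_ge0.
Qed.

(** With z = q x + k0 and D = k - k0, the error of the linearization of
    1 / (z + D) is D^2 / (z^2 (z + D)); a positive lower bound of z on the
    compact segment bounds it uniformly. *)
Lemma expands_at_div T p q k0 : 0 <= T ->
  {within `[0, T], continuous p} -> {within `[0, T], continuous q} ->
  (forall x, 0 <= x <= T -> 0 < q x + k0) ->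
  expands_at T (fun x k => p x / (q x + k)) k0
    (fun x => - (p x / (q x + k0) ^+ 2)).
Proof.
move=> T0 cp cq q0.
have [m m0 qm] : exists2 m, 0 < m & forall x, 0 <= x <= T -> m <= q x + k0.
  have [c] := EVT_min T0 cq; rewrite in_itv/= => cT qc.
  by exists (q c + k0); [exact: q0|move=> x xT; rewrite lerD2r qc// in_itv].
have [_ [B pB]] := continuous_bounded_mfun cp.
have B0 : 0 <= B by rewrite (le_trans _ (pB 0 _))// lexx.
have qm2 k x : `|k - k0| < m / 2 -> 0 <= x <= T -> m / 2 <= q x + k.
  move=> + /qm; rewrite ltr_norml => /andP[]; lra.
have cqk k : `|k - k0| < m / 2 ->
    {within `[0, T], continuous (fun x => (q x + k)^-1)}.
  move=> km; rewrite continuous_subspace_in => x.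
  rewrite inE/= in_itv/= => xT; apply: cvgV.
    by have := qm2 _ _ km xT => h; apply: lt0r_neq0; lra.
  by apply: cvgD; [exact: cq|exact: cvg_cst].
have kk0 : `|k0 - k0| < m / 2 by rewrite subrr normr0; lra.
split.
  have -> : (fun x => - (p x / (q x + k0) ^+ 2)) =
      (fun x => - (p x * ((q x + k0)^-1 * (q x + k0)^-1))).
    by apply/funext => x; rewrite -invfM -expr2.
  by move=> x; apply: cvgN; apply: cvgM; [exact: cp|apply: cvgM; exact: cqk].
exists (B * (2 / m ^+ 3)), (m / 2); first by lra.
move=> k km; split; first by move=> x; apply: cvgM; [exact: cp|exact: cqk].
move=> x xT; have z0 := qm _ xT; have zk := qm2 _ _ km xT.
set z := q x + k0 in z0 *.
have -> : q x + k = z + (k - k0) by rewrite /z; ring.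
set D := k - k0.
have zD : m / 2 <= z + D by rewrite /z /D; lra.
have zN0 : z != 0 by apply: lt0r_neq0; lra.
have zDN0 : z + D != 0 by apply: lt0r_neq0; lra.
rewrite (_ : _ - _ = p x * (D ^+ 2 / (z ^+ 2 * (z + D)))); last first.
  by field; rewrite zN0 zDN0.
rewrite normrM -mulrA ler_pM//; first exact: pB.
rewrite ger0_norm; last first.
  by rewrite divr_ge0 ?sqr_ge0// mulr_ge0// ?sqr_ge0//; lra.
rewrite mulrC ler_wpM2r ?sqr_ge0//.
rewrite -[leRHS]invrK invf_div lef_pV2 ?posrE; last 2 first.
- by rewrite mulr_gt0// ?exprn_gt0//; lra.
- by rewrite divr_gt0// exprn_gt0.
have -> : m ^+ 3 / 2 = m ^+ 2 * (m / 2) by ring.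
rewrite ler_pM// ?sqr_ge0//; first by lra.
by rewrite lerXn2r// nnegrE; lra.
Qed.

Lemma expands_at_cvg T e k0 e' x : 0 <= x <= T -> expands_at T e k0 e' ->
  e x k @[k --> k0] --> e x k0.
Proof.
move=> xT [ce' [C [d d0 H]]].
have HR : C * (k - k0) ^+ 2 + `|(k - k0) * e' x| @[k --> k0] --> (0 : R).
  rewrite [X in _ --> X](_ : 0 = C * (k0 - k0) ^+ 2 + `|(k0 - k0) * e' x|); last first.
    by rewrite subrr mul0r normr0 expr0n mulr0 addr0.
  have cs : k - k0 @[k --> k0] --> k0 - k0 by apply: cvgB; [exact: cvg_id|exact: cvg_cst].
  apply: cvgD; first by apply: cvgM; [exact: cvg_cst|exact: cvgM].
  by apply: cvg_norm; apply: cvgM => //; exact: cvg_cst.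
apply/cvgrPdist_le => eps eps0.
move/cvgrPdist_le : HR => /(_ _ eps0) HR.
near=> k.
have kd : `|k - k0| < d by rewrite distrC; near: k; exact: cvgr_dist_lt.
have [_ /(_ _ xT) Hk] := H k kd.
have : `|0 - (C * (k - k0) ^+ 2 + `|(k - k0) * e' x|)| <= eps by near: k.
rewrite sub0r normrN; apply: le_trans.
rewrite (le_trans _ (ler_norm _))//.
rewrite distrC -[e x k - _](subrK ((k - k0) * e' x)).
by rewrite (le_trans (ler_normD _ _))// lerD2r.
Unshelve. all: by end_near. Qed.

End expansion.

(** * Differentiability of functions of two real variables *)
Section differentiability.
Context {R : realType}.
Notation mu := (@lebesgue_measure R).

Lemma differentiable_fst (z : R * R) : differentiable (fst : R * R -> R) z.
Proof. by apply: linear_differentiable; move=> x; exact: cvg_fst. Qed.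

Lemma differentiable_snd (z : R * R) : differentiable (snd : R * R -> R) z.
Proof. by apply: linear_differentiable; move=> x; exact: cvg_snd. Qed.

(** A function that is negligible with respect to the distance has zero
    differential; perturbing by such a function preserves differentiability. *)
Lemma differentiable_littleo (V W : normedModType R) (G : V -> W) (z0 : V) :
  G z0 = 0 ->
  (forall eps : R, 0 < eps -> \forall z \near z0, `|G z| <= eps * `|z - z0|) ->
  differentiable G z0.
Proof.
move=> G0 H.
have c0 : continuous (0 : V -> W) by move=> ?; exact: cvg_cst.
have key : G \o shift z0 = cst (G z0) + (0 : V -> W) +o_ 0 id.
  apply/eqaddoP => eps eps0.
  have := H _ eps0; rewrite (near_shift 0 z0) subr0 => ?.
  near=> h.
  rewrite /= !fctE /= G0 !addr0 !subr0.
  have : `|G (h + z0)| <= eps * `|h + z0 - z0| by near: h.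
  by rewrite addrK.
apply/diff_locallyP.
have -> : 'd G z0 = 0 :> (V -> W).
  by apply/diff_unique.
by [].
Unshelve. all: by end_near. Qed.

Lemma near_eq_differentiable (V W : normedModType R) (F G : V -> W) (z0 : V) :
  (\forall z \near z0, F z = G z) -> differentiable F z0 -> differentiable G z0.
Proof.
move=> FG dF.
have -> : G = F + (G - F) by apply/funext => z; rewrite !fctE addrC subrK.
apply: differentiableD => //; apply: differentiable_littleo.
  by rewrite !fctE (nbhs_singleton FG) subrr.
move=> eps eps0; apply: filterS FG => z FGz.
by rewrite !fctE FGz subrr normr0 mulr_ge0// ltW.
Qed.

(** E(t, k) = E(t, k0) + (k - k0) E' t0 + (k - k0) (E' t - E' t0) + O((k - k0)^2).
    The first two terms are differentiable, and continuity of E' at t0 makes the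
    third one negligible. Differentiability in t is thus required for the single
    value k0 of the parameter. *)
Lemma differentiable_expansion T (E : R -> R -> R) (t0 k0 : R) E' :
  0 < t0 < T -> expands_at T E k0 E' -> derivable (E ^~ k0) t0 1 ->
  differentiable (fun z : R * R => E z.1 z.2) (t0, k0).
Proof.
move=> /andP[t00 t0T] [cE' [C [d d0 H]]] dE.
have -> : (fun z : R * R => E z.1 z.2) =
   ((E ^~ k0) \o fst + (E' t0 *: (snd - cst k0)))
   + (fun z => E z.1 z.2 - E z.1 k0 - E' t0 * (z.2 - k0)).
  by apply/funext => z /=; rewrite !fctE /= /GRing.scale /=; ring.
apply: differentiableD.
  apply: differentiableD.
    apply: differentiable_comp; first exact: differentiable_fst.
    exact/derivable1_diffP.
  apply: differentiableZ; apply: differentiableB; last exact: differentiable_cst.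
  exact: differentiable_snd.
apply: differentiable_littleo => /=; first by rewrite !subrr mulr0 subr0.
move=> eps eps0.
have cE't : {for t0, continuous E'}.
  have /continuous_within_itvP[//|+ _ _] : {within `[0, T], continuous E'} by [].
    exact: lt_trans t0T.
  by apply; rewrite in_itv/= t00.
have c1 : `|E' z.1 - E' t0| + `|C| * `|z.2 - k0| @[z --> (t0, k0)] --> (0 : R).
  rewrite [X in _ --> X](_ : 0 = `|E' t0 - E' t0| + `|C| * `|k0 - k0|); last first.
    by rewrite !subrr !normr0 mulr0 addr0.
  apply: cvgD.
    apply: cvg_norm; apply: cvgB; last exact: cvg_cst.
    by apply: (@cvg_comp _ _ _ fst E' _ (nbhs t0)); [exact: cvg_fst|exact: cE't].
  apply: cvgM; first exact: cvg_cst.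
  by apply: cvg_norm; apply: cvgB; [exact: cvg_snd|exact: cvg_cst].
have c11 : z.1 @[z --> (t0, k0)] --> t0 by exact: cvg_fst.
have c2 : z.2 @[z --> (t0, k0)] --> k0 by exact: cvg_snd.
near=> z.
have kd : `|z.2 - k0| < d by rewrite distrC; near: z; exact: cvgr_dist_lt.
have z1 : 0 <= z.1 <= T.
  apply/andP; split; apply: ltW.
    by near: z; exact: (cvgr_gt t0).
  by near: z; exact: (cvgr_lt t0).
have [_ /(_ _ z1) Hz] := H _ kd.
have small : `|0 - (`|E' z.1 - E' t0| + `|C| * `|z.2 - k0|)| <= eps.
  near: z.
  by move/cvgrPdist_le : c1 => /(_ _ eps0).
have z2le : `|z.2 - k0| <= `|z - (t0, k0)|.
  by rewrite [leRHS]/Num.norm/= le_max lexx orbT.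
rewrite (_ : _ - _ = (E z.1 z.2 - E z.1 k0 - (z.2 - k0) * E' z.1) +
    (z.2 - k0) * (E' z.1 - E' t0)); last by ring.
rewrite (le_trans (ler_normD _ _))//.
apply: le_trans (ler_wpM2l (ltW eps0) z2le).
rewrite sub0r normrN ger0_norm in small; last by rewrite addr_ge0// mulr_ge0.
apply: le_trans (ler_wpM2r (normr_ge0 (z.2 - k0)) small).
rewrite [leRHS]mulrDl [leLHS]addrC lerD//; first by rewrite normrM mulrC.
rewrite (le_trans Hz)// -[X in _ * X]real_normK ?num_real// expr2 mulrA.
by rewrite ler_wpM2r// ler_wpM2r// ler_norm.
Unshelve. all: by end_near. Qed.

(** Along a characteristic, ds is the coefficient of the s-derivative in the
    equation; the partial differential equation thus becomes an ordinary one. *)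
Lemma is_derive_along (w : R -> R -> R) (S : R -> R) (t s ds : R) :
  differentiable (fun z : R * R => w z.1 z.2) (t, s) ->
  S t = s -> is_derive t 1 S ds ->
  is_derive t 1 (fun x => w x (S x)) (derive1 (w ^~ s) t + ds * derive1 (w t) s).
Proof.
move=> dw St [dS dSE].
set W := fun z : R * R => w z.1 z.2.
have dSd : differentiable S t by exact/derivable1_diffP.
have dS' : 'd S t 1 = ds by rewrite -deriveE.
have didt : differentiable (@id R) t by [].
have did x : 'd (@id R) x = id :> (R -> R) by exact: diff_val.
have dgam : differentiable (fun x : R => (x, S x)) t by exact: differentiable_pair.
have curve (g : R -> R * R) x : differentiable g x -> g x = (t, s) ->
    differentiable (W \o g) x /\ 'd (W \o g) x 1 = 'd W (t, s) ('d g x 1).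
  move=> dg gx; split; first by apply: differentiable_comp => //; rewrite gx.
  by rewrite diff_comp ?gx.
have d1 : derive1 (w ^~ s) t = 'd W (t, s) (1, 0).
  have dg : differentiable (fun x : R => (x, cst s x)) t by exact: differentiable_pair.
  have [a b] := curve _ _ dg erefl.
  rewrite derive1E (_ : w ^~ s = W \o (fun x : R => (x, cst s x)))// deriveE// b.
  by rewrite diff_pair// diff_cst did.
have d2 : derive1 (w t) s = 'd W (t, s) (0, 1).
  have dg : differentiable (fun x : R => (cst t x, x)) s by exact: differentiable_pair.
  have [a b] := curve _ _ dg erefl.
  rewrite derive1E (_ : w t = W \o (fun x : R => (cst t x, x)))// deriveE// b.
  by rewrite diff_pair// diff_cst did.
have gt : (t, S t) = (t, s) by rewrite St.
have [a b] := curve _ _ dgam gt.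
rewrite (_ : (fun x => w x (S x)) = W \o (fun x => (x, S x)))//.
apply: DeriveDef; first exact: diff_derivable.
rewrite deriveE// b diff_pair// did dS' d1 d2.
rewrite (_ : (1, ds) = (1, 0) + ds *: (0, 1)); last first.
  by apply: injective_projections => /=; rewrite /GRing.scale/= ?mulr0 ?addr0 ?mulr1 ?add0r.
by rewrite linearD linearZ.
Qed.

End differentiability.

(** * Integrals and derivatives on the line *)
Section derivatives_of_integrals.
Context {R : realType}.
Notation mu := (@lebesgue_measure R).

Lemma is_derive_slope (f : R -> R) (x l : R) :
  h^-1 * (f (h + x) - f x) @[h --> 0^'] --> l -> is_derive x 1 f l.
Proof.
move=> fl.
have fl' : h^-1 *: ((f \o shift x) h%:A - f x) @[h --> 0^'] --> l.
  by under eq_fun do rewrite /= [_%:A]mulr1.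
apply: DeriveDef; first by apply/cvg_ex; exists l.
exact/cvg_lim.
Qed.

Lemma slope_is_derive (f : R -> R) (x l : R) :
  is_derive x 1 f l -> h^-1 * (f (h + x) - f x) @[h --> 0^'] --> l.
Proof.
move=> [/cvg_ex[/= l' fl'] fE].
have ll' : l = l' by rewrite -fE; exact/cvg_lim.
move: fl'; rewrite -ll'.
by under eq_fun do rewrite /= [_%:A]mulr1.
Qed.

Lemma is_derive_expR_decay (b x : R) :
  is_derive x 1 (fun y => expR (- (b * y))) (- b * expR (- (b * x))).
Proof.
rewrite mulrC; apply: (@is_derive1_comp R expR (fun y => - (b * y))).
rewrite -[X in is_derive _ _ _ X]mulr1 mulNr.
by apply: is_deriveN; apply: (@is_deriveZ R R R id b).
Qed.

Lemma continuous_expR_decay (b : R) : continuous (fun y => expR (- (b * y))).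
Proof.
move=> x; apply: differentiable_continuous; apply/derivable1_diffP.
by have [] := is_derive_expR_decay b x.
Qed.

Lemma Rintegral_FTC (F f : R -> R) (a b : R) : a <= b ->
  {within `[a, b], continuous f} -> {within `[a, b], continuous F} ->
  (forall x, a < x < b -> is_derive x 1 F (f x)) ->
  \int[mu]_(x in `[a, b]) f x = F b - F a.
Proof.
rewrite le_eqVlt => /predU1P[<- _ _ _|ab cf cF dF].
  by rewrite set_itv1 Rintegral_set1 subrr.
rewrite /Rintegral (@continuous_FTC2 _ f F)//.
- have [c1 c2 c3] := (continuous_within_itvP _ ab).1 cF.
  split => // x; rewrite in_itv/= => /dF[].
  by [].
- move=> x; rewrite in_itv/= => /dF[dx <-].
  by rewrite derive1E.
Qed.

Lemma is_derive_Rintegral_continuous (f : R -> R) (a x u : R) : a < x -> x < u ->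
  mu.-integrable `[a, u] (EFin \o f) -> {for x, continuous f} ->
  is_derive x 1 (fun t => \int[mu]_(y in `[a, t]) f y) (f x).
Proof.
move=> ax xu intf cf.
have [dF FE] := continuous_FTC1_closed xu intf ax cf.
by apply: (DeriveDef dF); rewrite -derive1E; exact: FE.
Qed.

(** A point at which the primitive of f has derivative f t remains such a point
    for f multiplied by any continuous weight e: the integral of
    f (e - e t) over a short interval around t is small compared with its length,
    f being bounded. Hence one exceptional null set serves all weights. *)
Lemma is_derive_Rintegral_weight T (f e : R -> R) (t : R) : 0 < t < T ->
  bounded_mfun 0 T f -> {within `[0, T], continuous e} ->
  is_derive t 1 (fun x => \int[mu]_(y in `[0, x]) f y) (f t) ->
  is_derive t 1 (fun x => \int[mu]_(y in `[0, x]) (f y * e y)) (f t * e t).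
Proof.
move=> /andP[t0 tT] bf ce dF.
have T0 : 0 < T by exact: lt_trans tT.
have be := continuous_bounded_mfun ce.
have bg : bounded_mfun 0 T (fun y => f y * (e y - e t)).
  by apply: bounded_mfunM => //; apply: bounded_mfunB => //; exact: bounded_mfun_cst.
pose N x := \int[mu]_(y in `[0, x]) (f y * (e y - e t)).
have cet : {for t, continuous e}.
  have [+ _ _] := (continuous_within_itvP _ T0).1 ce.
  by apply; rewrite in_itv/= t0.
have [_ [M fM]] := bf.
have M0 : 0 <= M by rewrite (le_trans _ (fM 0 _))// lexx ltW.
have dN : is_derive t 1 N 0.
  apply: is_derive_slope.
  apply/cvgrPdist_le => eps eps0.
  have eM : 0 < eps / (M + 1) by rewrite divr_gt0// ltr_wpDl.
  move/cvgrPdist_lt : cet => /(_ _ eM) [d /= d0 Hd].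
  have hnear : \forall h \near (0:R)^', `|h| < d /\ `|h| < t /\ `|h| < T - t.
    near=> h; do 2 try split; near: h; apply: dnbhs0_lt => //.
    by rewrite subr_gt0.
  apply: filterS hnear => h [hd [ht hT]].
  rewrite sub0r normrN.
  have [->|h0] := eqVneq h 0; first by rewrite add0r subrr mulr0 normr0 ltW.
  rewrite normrM normfV ler_pdivrMl ?normr_gt0// mulrC.
  have small y : `|t - y| < d -> 0 <= y <= T -> `|f y * (e y - e t)| <= eps.
    move=> ty yT; rewrite normrM.
    have := Hd y ty; rewrite distrC => /ltW ee.
    apply: (@le_trans _ _ (M * (eps / (M + 1)))); first by rewrite ler_pM// fM.
    rewrite mulrCA; apply: ler_piMr; first exact: ltW.
    by rewrite ler_pdivrMr ?mul1r ?lerDl ?ltr_wpDl.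
  have split_at x y : 0 <= x -> x <= y -> y <= T ->
      N y - N x = \int[mu]_(z in `[x, y]) (f z * (e z - e t)).
    move=> x0 xy yT; rewrite /N (Rintegral_split (b := x) (c := y))//.
      by rewrite addrC addKr.
    exact: bounded_mfunS bg.
  move: ht hT hd; rewrite !ltr_norml => /andP[h1 h2] /andP[h3 h4] /andP[h5 h6].
  have [hpos|hneg] := leP 0 h.
  - rewrite split_at; [|lra|lra|lra].
    apply: le_trans.
      apply: (@norm_Rintegral_le _ _ _ _ eps); first by lra.
        by apply: bounded_mfunS bg; lra.
      move=> y /andP[y1 y2]; apply: small; last by lra.
      by rewrite ltr_norml; lra.
    by rewrite ger0_norm// addrK.
  - rewrite distrC split_at; [|lra|lra|lra].
    apply: le_trans.
      apply: (@norm_Rintegral_le _ _ _ _ eps); first by lra.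
        by apply: bounded_mfunS bg; lra.
      move=> y /andP[y1 y2]; apply: small; last by lra.
      by rewrite ltr_norml; lra.
    by rewrite ltr0_norm//; lra.
pose F x := \int[mu]_(y in `[0, x]) f y.
have dNF : is_derive t 1 (N + e t *: F) (0 + e t *: f t) by exact: is_deriveD.
have -> : f t * e t = 0 + e t *: f t by rewrite add0r /GRing.scale/= mulrC.
apply: near_eq_is_derive dNF => //.
near=> x.
have x0 : 0 < x by near: x; exact: lt_nbhsr.
have xT : x < T by near: x; exact: lt_nbhsl.
have bfx : bounded_mfun 0 x f by apply: bounded_mfunS bf => //; exact: ltW.
have bgx : bounded_mfun 0 x (fun y => f y * (e y - e t)).
  by apply: bounded_mfunS bg => //; exact: ltW.
rewrite !fctE/= /N /F /GRing.scale/= -RintegralZl//; last exact: bounded_mfun_integrable.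
rewrite -RintegralD//=; last 2 first.
- exact: bounded_mfun_integrable.
- apply: bounded_mfun_integrable; apply: bounded_mfunM => //.
  exact: bounded_mfun_cst.
by apply: eq_Rintegral => y _; ring.
Unshelve. all: by end_near. Qed.

(** A bounded derivative is integrable with the expected integral, although it
    may be nowhere continuous. The derivative at x = 0 of the integral over
    y in [a, b] of F (x + y) is computed in two ways: under the integral sign,
    which yields the integral of F', and through a primitive H of F, since that
    integral is H (x + b) - H (x + a). *)
Lemma FTC_bounded_derivative (F F' : R -> R) (u v a b M : R) :
  u < a -> a <= b -> b < v ->
  (forall x, u < x < v -> is_derive x 1 F (F' x)) ->
  (forall x, u < x < v -> `|F' x| <= M) ->
  \int[mu]_(x in `[a, b]) F' x = F b - F a.
Proof.
move=> ua ab bv dF F'M.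
pose d := Num.min (a - u) (v - b) / 4.
have d0 : 0 < d by rewrite divr_gt0// lt_min !subr_gt0 ua bv.
have du : 4 * d <= a - u by rewrite mulrC divfK// ge_min lexx.
have dv : 4 * d <= v - b by rewrite mulrC divfK// ge_min lexx orbT.
have M0 : 0 <= M by rewrite (le_trans _ (F'M a _))// ua (le_lt_trans ab).
have cF x : u < x < v -> {for x, continuous F}.
  by move=> /dF[dx _]; apply: differentiable_continuous; exact/derivable1_diffP.
have cFab p q : u < p -> q < v -> {within `[p, q], continuous F}.
  move=> up qv; apply: continuous_in_subspaceT => x.
  rewrite inE/= in_itv/= => /andP[px xq]; apply: cF.
  by rewrite (lt_le_trans up)//= (le_lt_trans xq).
pose H x := \int[mu]_(y in `[a - 3 * d, x]) F y.
have dH x : a - 3 * d < x < b + 3 * d -> is_derive x 1 H (F x).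
  move=> /andP[x1 x2]; apply: (@is_derive_Rintegral_continuous _ _ _ (b + 3 * d)) => //.
    apply: bounded_mfun_integrable.
    by apply: continuous_bounded_mfun; apply: cFab; lra.
  by apply: cF; lra.
have cFs x : `|x| < d -> {within `[a, b], continuous (fun y => F (x + y))}.
  move=> xd; apply: continuous_in_subspaceT => y.
  rewrite inE/= in_itv/= => /andP[ay yb].
  apply: (@continuous_comp _ _ _ (fun y => x + y) F).
    by apply: cvgD; [exact: cvg_cst|exact: cvg_id].
  by apply: cF; move: xd; rewrite ltr_norml; lra.
have dFs x y : -d < x < d -> a <= y <= b ->
    is_derive x 1 (fun x => F (x + y)) (F' (x + y)).
  move=> xd yab.
  have h1 : is_derive (x + y) 1 F (F' (x + y)) by apply: dF; lra.
  have h2 : is_derive x 1 (fun x => x + y) 1.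
    by have -> : (fun x => x + y) = shift y by []; exact: is_derive_shift.
  have := @is_derive1_comp R F (fun x => x + y) _ _ _ h1 h2.
  by rewrite mulr1.
pose f2 x y := F (x + y).
have p2E x y : -d < x < d -> a <= y <= b -> partial1of2 f2 x y = F' (x + y).
  by move=> xd yab; have [_ <-] := dFs _ _ xd yab; rewrite partial1of2E.
have hint x : `]- d, d[%classic x -> mu.-integrable `[a, b] (EFin \o f2 x).
  rewrite /= in_itv/= => xd; apply: bounded_mfun_integrable.
  by apply: continuous_bounded_mfun; apply: cFs; rewrite ltr_norml.
have hder x y : `]- d, d[%classic x -> `[a, b]%classic y ->
    derivable (f2 ^~ y) x 1.
  by rewrite /= !in_itv/= => xd yab; have [] := dFs _ _ xd yab.
have hM : mu.-integrable `[a, b] (EFin \o cst M).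
  exact: (bounded_mfun_integrable (bounded_mfun_cst a b M)).
have hbnd x y : `]- d, d[%classic x -> `[a, b]%classic y ->
    `|partial1of2 f2 x y| <= cst M y.
  by rewrite /= !in_itv/= => xd yab; rewrite p2E//; apply: F'M; lra.
have J0 : `]- d, d[%classic (0 : R) by rewrite /= in_itv/=; lra.
have := @cvg_differentiation_under_integral R _ _ mu f2 `[a, b]
  (measurable_itv _) 0 (- d) d J0 hint hder (cst M) (fun=> M0) hM hbnd.
have -> : \int[mu]_(y in `[a, b]) partial1of2 f2 0 y = \int[mu]_(y in `[a, b]) F' y.
  apply: eq_Rintegral => y; rewrite inE/= in_itv/= => yab.
  by rewrite p2E ?add0r//; lra.
move=> lim1.
have intE h : `|h| < d -> \int[mu]_(y in `[a, b]) f2 h y = H (h + b) - H (h + a).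
  move=> hd; apply: (@Rintegral_FTC (fun y => H (h + y))) => //.
  - exact: cFs.
  - apply: derivable_within_continuous => y; rewrite in_itv/= => yab.
    have [] // : is_derive y 1 (fun y => H (h + y)) (F (h + y) * 1).
    apply: (@is_derive1_comp R H (fun y => h + y)).
      by apply: dH; move: hd; rewrite ltr_norml; lra.
    rewrite -[X in is_derive _ _ _ X]add0r.
    by apply: is_deriveD.
  - move=> y yab; rewrite -[X in is_derive _ _ _ X]mulr1.
    apply: (@is_derive1_comp R H (fun y => h + y)).
      by apply: dH; move: hd; rewrite ltr_norml; lra.
    rewrite -[X in is_derive _ _ _ X]add0r.
    by apply: is_deriveD.
have lim2 : h^-1 *: (\int[mu]_(y in `[a, b]) f2 (h + 0) y
    - \int[mu]_(y in `[a, b]) f2 0 y) @[h --> 0^'] --> F b - F a.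
  have Hb := slope_is_derive (dH b _); have Ha := slope_is_derive (dH a _).
  have : h^-1 * (H (h + b) - H b) - h^-1 * (H (h + a) - H a) @[h --> 0^'] --> F b - F a.
    by apply: cvgB; [apply: Hb|apply: Ha]; lra.
  apply: cvg_trans; apply: near_eq_cvg; near=> h.
  rewrite addr0 !intE ?normr0// ?add0r; last by near: h; exact: dnbhs0_lt.
  by rewrite /GRing.scale/=; ring.
exact: cvg_unique lim1 lim2.
Unshelve. all: by end_near. Qed.

End derivatives_of_integrals.

(** * Primitives of locally bounded functions *)
Section locally_bounded_functions.
Context {R : realType}.
Notation mu := (@lebesgue_measure R).
Implicit Types (f : R -> R) (T t : R).

Let measurable_fun_add0 f :
  measurable_fun (`]0, +oo[ : set R) f -> measurable_fun (`[0, +oo[ : set R) f.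
Proof.
move=> mf; rewrite -(@setU1itv _ R (BInfty _ false) 0 false)//.
by apply/measurable_funU => //; split => //; exact: measurable_fun_set1.
Qed.

Lemma locally_bounded_mfun f T : measurable_fun (`]0, +oo[ : set R) f ->
  locally_bounded f -> bounded_mfun 0 T f.
Proof.
move=> /measurable_fun_add0 mf /(_ T)[M fM]; split.
  by apply: measurable_funS mf => //; exact: subset_itvl.
exists (Num.max M `|f 0|) => x /andP[]; rewrite le_eqVlt => /predU1P[<- _|x0 xT].
  by rewrite le_max lexx orbT.
by rewrite le_max fM ?x0.
Qed.

(** Lebesgue's differentiation theorem, for f extended by 0 to the left of 0. *)
Lemma ae_is_derive_Rintegral f : measurable_fun (`]0, +oo[ : set R) f ->
  locally_bounded f ->
  {ae mu, forall t, 0 < t ->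
     is_derive t 1 (fun x => \int[mu]_(y in `[0, x]) f y) (f t)}.
Proof.
move=> mf lf.
pose g := f \_ `[0, +oo[.
have gE x : 0 <= x -> g x = f x.
  by move=> x0; rewrite /g patchE mem_set//= in_itv/= x0.
have mg : measurable_fun setT g.
  by apply/(measurable_restrictT _ _).1 => //; exact: measurable_fun_add0.
have bg a T : bounded_mfun a T g.
  split; first exact: measurable_funS mg.
  have [_ [M fM]] := locally_bounded_mfun T mf lf.
  exists (Num.max M 0) => x /andP[ax xT]; have [x0|x0] := leP 0 x.
    by rewrite gE// le_max fM ?x0.
  by rewrite /g patchE memNset ?normr0 ?le_max ?lexx ?orbT//= in_itv/= leNgt x0.
have lg : locally_integrable setT g.
  split => //; first exact: openT.
  move=> K _ cK.
  have [a [b Kab]] : exists a b, K `<=` `[a, b].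
    have [N [_ /(_ (`|N| + 1))]] := compact_bounded cK.
    rewrite ltr_pwDr ?ler_norm// => /(_ isT) KN.
    exists (- (`|N| + 1)), (`|N| + 1) => x /KN /=.
    by rewrite in_itv/= ler_norml.
  have : mu.-integrable K (EFin \o g).
    apply: (@integrableS _ _ _ mu `[a, b]) => //; first exact: compact_measurable.
    exact: bounded_mfun_integrable.
  by move=> /integrableP[].
have := lebesgue_differentiation lg.
apply: filterS; first exact: (ae_filter_ringOfSetsType mu).
move=> t gt t0.
have tt1 : t < t + 1 by rewrite ltrDl.
have [dG GE] := @FTC1_lebesgue_pt R g (BLeft 0) t (t + 1) tt1
  (bounded_mfun_integrable (bg 0 (t + 1))) t0 gt.
rewrite -(gE t (ltW t0)).
have dg : is_derive t 1 (fun x => \int[mu]_(y in `[0, x]) g y) (g t).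
  by apply: DeriveDef; rewrite -?derive1E.
apply: near_eq_is_derive dg => //.
near=> x; apply: eq_Rintegral => y; rewrite inE/= in_itv/= => /andP[y0 _].
by rewrite gE.
Unshelve. all: by end_near. Qed.

Lemma is_derive_Rintegral_source f t : {in `]0, +oo[, continuous f} ->
  locally_bounded f -> 0 < t ->
  is_derive t 1 (fun x => \int[mu]_(y in `[0, x]) f y) (f t).
Proof.
move=> cf lf t0.
have mf : measurable_fun (`]0, +oo[ : set R) f.
  by apply: open_continuous_measurable_fun => // x; rewrite inE/= => /cf.
apply: (@is_derive_Rintegral_continuous _ _ _ _ (t + 1)) => //.
- by rewrite ltrDl.
- by apply: bounded_mfun_integrable; exact: locally_bounded_mfun.
- by apply: cf; rewrite in_itv/= t0.
Qed.

End locally_bounded_functions.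

(** * The scaled incomplete gamma function *)
Section gamma.
Context {R : realType}.
Notation mu := (@lebesgue_measure R).
Implicit Types (q T x b v t : R).

Let powR_continuous_itv q x : 0 < x -> {for x, continuous (fun y => y `^ q)}.
Proof.
move=> x0; apply: differentiable_continuous; apply/derivable1_diffP.
by apply: derivable_powR; rewrite in_itv/= x0.
Qed.

Let integral_powR q (d T : R) : 0 < q -> 0 < d -> 0 <= T ->
  (\int[mu]_(x in `[d, T]) (x `^ (q - 1))%:E <= (T `^ q / q)%:E)%E.
Proof.
move=> q0 d0 T0.
have pos : 0 <= T `^ q / q by rewrite divr_ge0 ?powR_ge0// ltW.
have [dT|Td] := ltP d T; last first.
  move: Td; rewrite le_eqVlt => /predU1P[<-|Td].
    by rewrite set_itv1 integral_set1 lee_fin.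
  by rewrite set_itv_ge ?bnd_simp -?ltNge// integral_set0 lee_fin.
pose F x := x `^ q / q.
have dF x : 0 < x -> is_derive x 1 F (x `^ (q - 1)).
  move=> x0; rewrite (_ : F = q^-1 *: (fun x => x `^ q)); last first.
    by apply/funext => y; rewrite /F !fctE /GRing.scale/= mulrC.
  rewrite (_ : x `^ (q - 1) = q^-1 *: (q * x `^ (q - 1))); last first.
    by rewrite /GRing.scale/= mulKf// gt_eqF.
  by apply: is_deriveZ; exact: is_derive1_powR.
have cF x : 0 < x -> {for x, continuous F}.
  move=> x0; apply: differentiable_continuous; apply/derivable1_diffP.
  by have [] := dF _ x0.
rewrite (@continuous_FTC2 _ _ F)//.
- by rewrite -EFinB lee_fin lerBlDr lerDl divr_ge0 ?powR_ge0// ltW.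
- apply: continuous_in_subspaceT => x; rewrite inE/= in_itv/= => /andP[dx _].
  by apply: powR_continuous_itv; exact: lt_le_trans dx.
- have : {within `[d, T], continuous F}.
    apply: continuous_in_subspaceT => x; rewrite inE/= in_itv/= => /andP[dx _].
    by apply: cF; exact: lt_le_trans dx.
  move/(continuous_within_itvP _ dT) => [_ c1 c2]; split => // x.
  rewrite in_itv/= => /andP[dx _].
  by have [] := dF _ (lt_trans d0 dx).
- move=> x; rewrite in_itv/= => /andP[dx _].
  by have [_ <-] := dF _ (lt_trans d0 dx); rewrite derive1E.
Qed.

(** The integrals over [1/(n+1), T] are bounded by T^q / q, and they increase to
    the integral over ]0, T]. *)
Lemma integrable_powR q T : 0 < q -> 0 <= T ->
  mu.-integrable `[0, T] (fun x => (x `^ (q - 1))%:E).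
Proof.
move=> q0 T0.
have mf D : measurable_fun D (fun x : R => (x `^ (q - 1))%:E).
  apply/measurable_EFinP; apply: measurable_funTS.
  exact: measurable_powR.
apply/integrableP; split; first exact: mf.
under eq_integral => x _ do rewrite /= ger0_norm ?powR_ge0//.
rewrite -integral_itv_obnd_cbnd; last exact: mf.
pose F (n : nat) : set R := `[n.+1%:R^-1, T]%classic.
have -> : `]0, T]%classic = \bigcup_n F n.
  apply/seteqP; split => x; rewrite /F /= ?in_itv/=.
    move=> /andP[x0 xT].
    have /ltr_add_invr [n] := x0; rewrite add0r => nx.
    by exists n => //=; rewrite in_itv/= xT ltW.
  move=> [n _]; rewrite /= in_itv/= => /andP[nx ->].
  by rewrite (lt_le_trans _ nx)// invr_gt0.
have ndF : {homo F : n m / (n <= m)%N >-> (n <= m)%O}.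
  move=> n m nm; apply/subsetPset; apply: subset_itvr.
  by rewrite bnd_simp lef_pV2 ?posrE ?ler_nat.
have := @ge0_nondecreasing_set_cvg_integral _ (measurableTypeR R) R F
  (fun x : R => (x `^ (q - 1))%:E) mu ndF (fun=> measurable_itv _) (fun=> mf _).
move=> /(_ (fun n x _ => powR_ge0 _ _))/cvg_lim <- //.
apply: (@le_lt_trans _ _ (T `^ q / q)%:E); last by rewrite ltry.
apply: lime_le.
  apply: ereal_nondecreasing_is_cvgn => n m nm.
  apply: ge0_subset_integral.
  - exact: measurable_itv.
  - exact: measurable_itv.
  - exact: mf.
  - by move=> x _; exact: powR_ge0.
  apply: subset_itvr.
  by rewrite bnd_simp lef_pV2 ?posrE ?ler_nat.
by apply: nearW => n; apply: integral_powR; rewrite ?invr_gt0.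
Qed.

Lemma integrable_powR_expR q b T : 0 < q -> 0 <= T ->
  mu.-integrable `[0, T] (fun x => (x `^ (q - 1) * expR (- (b * x)))%:E).
Proof.
move=> q0 T0.
have mh : measurable_fun setT (fun x : R => x `^ (q - 1) * expR (- (b * x))).
  apply: measurable_funM; first exact: measurable_powR.
  by apply: continuous_measurable_fun; exact: continuous_expR_decay.
have : mu.-integrable `[0, T] (fun x => ((expR (`|b| * T))%:E * (x `^ (q - 1))%:E)%E).
  by apply: integrableZl => //; exact: integrable_powR.
apply: le_integrable => //.
  by apply/measurable_EFinP; exact: measurable_funS mh.
move=> x; rewrite /= in_itv/= => /andP[x0 xT].
rewrite lee_fin !normrM !(ger0_norm (expR_ge0 _)).
rewrite mulrC ler_wpM2r// ler_expR.
rewrite (le_trans (ler_norm _))// normrN normrM ler_wpM2l//.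
by rewrite ger0_norm.
Qed.

Lemma integrable_expR_decay b : 0 < b ->
  mu.-integrable `[0, +oo[ (fun x => (expR (- (b * x)))%:E).
Proof.
move=> b0.
have : mu.-integrable `[0, +oo[ (fun x => (b^-1%:E * (exponential_pdf b x)%:E)%E).
  apply: integrableZl => //.
  by apply: (@integrableS _ _ _ mu setT) => //; exact: integrable_exponential_pdf.
apply: le_integrable => //.
  apply/measurable_EFinP; apply: measurable_funTS.
  by apply: continuous_measurable_fun; exact: continuous_expR_decay.
move=> x x0.
rewrite /= exponential_pdfE; last by move: x0; rewrite /= in_itv/= andbT.
by rewrite lee_fin mulKf ?gt_eqF// mulNr.
Qed.

(** From y <= e^y at y = x / (2 N), with N = |p| + 1, raised to the power N. *)
Let powR_le_expR (p x : R) : 1 <= x ->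
  x `^ p <= (2 * (`|p| + 1)) `^ (`|p| + 1) * expR (x / 2).
Proof.
move=> x1; set N := `|p| + 1.
have N0 : 0 < N by rewrite ltr_wpDl.
apply: (@le_trans _ _ (x `^ N)).
  by apply: ler_powR => //; rewrite (le_trans (ler_norm _))// lerDl.
have -> : expR (x / 2) = expR (x / (2 * N)) `^ N.
  by rewrite -expRM invfM mulrA divfK// gt_eqF.
rewrite -powRM ?expR_ge0//; last by lra.
apply: ge0_ler_powR; rewrite ?nnegrE ?mulr_ge0 ?expR_ge0//; [lra|lra|lra|].
rewrite mulrC -ler_pdivrMr; last by lra.
by have := expR_ge1Dx (x / (2 * N)); lra.
Qed.

(** Dominated by x^(q - 1) on [0, 1] and by a multiple of e^(- x / 2) beyond. *)
Lemma integrable_gamma q : 0 < q ->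
  mu.-integrable `[0, +oo[ (fun x => (x `^ (q - 1) * expR (- x))%:E).
Proof.
move=> q0.
pose C := (2 * (`|q - 1| + 1)) `^ (`|q - 1| + 1).
pose g1 : R -> \bar R := (fun x => (x `^ (q - 1))%:E) \_ `[0, 1].
have i1 : mu.-integrable `[0, +oo[ g1.
  apply/integrable_restrict => //.
  rewrite setIidr; first exact: integrable_powR.
  by apply: subset_itvl.
have i2 : mu.-integrable `[0, +oo[ (fun x => (C%:E * (expR (- (2^-1 * x)))%:E)%E).
  by apply: integrableZl => //; apply: integrable_expR_decay.
have : mu.-integrable `[0, +oo[ (g1 \+
    (fun x => (C%:E * (expR (- (2^-1 * x)))%:E)%E))%E.
  exact: integrableD.
apply: le_integrable => //.
  apply/measurable_EFinP; apply: measurable_funTS.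
  apply: measurable_funM; first exact: measurable_powR.
  by apply: measurableT_comp.
move=> x; rewrite /= in_itv/= andbT => x0.
rewrite /g1 patchE; case: ifPn => [_|].
  rewrite -EFinM -EFinD !lee_fin !ger0_norm ?addr_ge0 ?mulr_ge0 ?powR_ge0 ?expR_ge0//.
  apply: ler_wpDr; first by rewrite mulr_ge0 ?powR_ge0 ?expR_ge0.
  by rewrite ler_piMr ?powR_ge0// -expR0 ler_expR oppr_le0.
rewrite notin_setE/= in_itv/= x0 /= => /negP; rewrite -ltNge => x1.
have C0 : 0 <= C by exact: powR_ge0.
rewrite add0r lee_fin !ger0_norm ?mulr_ge0 ?powR_ge0 ?expR_ge0//.
rewrite (_ : - x = x / 2 * -1 - 2^-1 * x); last by field.
rewrite expRD mulrA ler_wpM2r ?expR_ge0// mulrN1 expRN.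
rewrite ler_pdivrMr ?expR_gt0//; apply: powR_le_expR; exact: ltW.
Qed.

(** Writing the upper incomplete gamma function through a primitive that starts
    at 0 gives both signs of b the same treatment. *)
Lemma scaled_gamma_posE b v t : 0 < b -> 0 < v -> 0 <= t ->
  scaled_gamma b v t = b `^ (- (2 * v)) *
   (upper_gamma (2 * v) 0 -
    \int[mu]_(x in `[0, b * t]) (x `^ (2 * v - 1) * expR (- (1 * x)))).
Proof.
move=> b0 v0 t0; rewrite /scaled_gamma b0; congr (_ * _).
have bt0 : 0 <= b * t by rewrite mulr_ge0// ltW.
have ig : mu.-integrable `[0, +oo[
    (EFin \o (fun x => x `^ (2 * v - 1) * expR (- x))).
  by apply: integrable_gamma; lra.
under eq_Rintegral do rewrite mul1r.
have := Rintegral_itvB ig (x := b * t); rewrite !bnd_simp => /(_ bt0 isT).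
rewrite Rintegral_itv_obnd_cbnd => [E|]; first by rewrite /upper_gamma -E.
by apply: (@integrableS _ _ _ mu `[0, +oo[) => //; apply: subset_itvr; rewrite bnd_simp.
Qed.

Section primitive.
Variables (q b : R).
Hypothesis q0 : 0 < q.
Let H t := \int[mu]_(x in `[0, t]) (x `^ (q - 1) * expR (- (b * x))).

Lemma is_derive_gamma_primitive t : 0 < t ->
  is_derive t 1 H (t `^ (q - 1) * expR (- (b * t))).
Proof.
move=> t0; apply: (@is_derive_Rintegral_continuous _ _ _ _ (t + 1)) => //.
- by rewrite ltrDl.
- by apply: integrable_powR_expR => //; lra.
- apply: cvgM; first exact: powR_continuous_itv.
  exact: continuous_expR_decay.
Qed.

Lemma gamma_primitive_cvg0 : H t @[t --> 0^'+] --> H 0.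
Proof.
have : {within `[0, 1], continuous H}.
  apply: parameterized_integral_continuous => //.
  exact: integrable_powR_expR.
by move/(continuous_within_itvP _ ltr01) => [].
Qed.

End primitive.

Lemma is_derive_scaled_gamma b v t : 0 < v -> 0 < t ->
  is_derive t 1 (scaled_gamma b v) (- (t `^ (2 * v - 1) * expR (- (b * t)))).
Proof.
move=> v0 t0; have q0 : 0 < 2 * v by lra.
have [b0|b0] := ltP 0 b; last first.
  have -> : scaled_gamma b v = - (fun t => \int[mu]_(x in `[0, t])
      (x `^ (2 * v - 1) * expR (- (b * x)))).
    by apply/funext => x; rewrite /scaled_gamma ltNge b0.
  by apply: is_deriveN; exact: is_derive_gamma_primitive.
pose H t := \int[mu]_(x in `[0, t]) (x `^ (2 * v - 1) * expR (- (1 * x))).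
have bt0 : 0 < b * t by rewrite mulr_gt0.
have dHb : is_derive t 1 (fun t => H (b * t))
    ((b * t) `^ (2 * v - 1) * expR (- (1 * (b * t))) * b).
  apply: (@is_derive1_comp R H (fun y => b * y)).
    exact: is_derive_gamma_primitive.
  rewrite -[X in is_derive _ _ _ X]mulr1.
  exact: (@is_deriveZ R R R id b).
have d2 : is_derive t 1
    (b `^ (- (2 * v)) *: (cst (upper_gamma (2 * v) 0) - (fun t => H (b * t))))
    (b `^ (- (2 * v)) *:
      (0 - (b * t) `^ (2 * v - 1) * expR (- (1 * (b * t))) * b)).
  by apply: is_deriveZ; apply: is_deriveB.
rewrite (_ : - _ = b `^ (- (2 * v)) *:
    (0 - (b * t) `^ (2 * v - 1) * expR (- (1 * (b * t))) * b)); last first.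
  rewrite /GRing.scale/= sub0r mulrN; congr (- _).
  rewrite powRM ?ltW// mul1r.
  rewrite (_ : _ * (_ * _ * _ * _) = (b `^ (- (2 * v)) * (b * b `^ (2 * v - 1))) *
    (t `^ (2 * v - 1) * expR (- (b * t)))); last by ring.
  rewrite mulr_powRB1 ?ltW// powRN mulVf ?mul1r//.
  by rewrite gt_eqF// powR_gt0.
apply: near_eq_is_derive d2 => //.
near=> x; rewrite scaled_gamma_posE//.
by apply/ltW; near: x; exact: lt_nbhsr.
Unshelve. all: by end_near. Qed.

Lemma scaled_gamma_cvg0 b v : 0 < v ->
  scaled_gamma b v t @[t --> 0^'+] --> scaled_gamma b v 0.
Proof.
move=> v0; have q0 : 0 < 2 * v by lra.
have [b0|b0] := ltP 0 b; last first.
  have -> : scaled_gamma b v = - (fun t => \int[mu]_(x in `[0, t])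
      (x `^ (2 * v - 1) * expR (- (b * x)))).
    by apply/funext => x; rewrite /scaled_gamma ltNge b0.
  by apply: cvgN; exact: gamma_primitive_cvg0.
pose H t := \int[mu]_(x in `[0, t]) (x `^ (2 * v - 1) * expR (- (1 * x))).
rewrite scaled_gamma_posE// mulr0.
have : b `^ (- (2 * v)) * (upper_gamma (2 * v) 0 - H (b * t)) @[t --> 0^'+] -->
     b `^ (- (2 * v)) * (upper_gamma (2 * v) 0 - H 0).
  apply: cvgM; first exact: cvg_cst.
  apply: cvgB; first exact: cvg_cst.
  have cH := @gamma_primitive_cvg0 _ 1 q0.
  apply/cvgrPdist_lt => e e0.
  move/cvgrPdist_lt : cH => /(_ _ e0)[d /= d0 Hd].
  near=> t.
  have t0 : 0 < t by near: t; exact: nbhs_right_gt.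
  apply: Hd; last by rewrite mulr_gt0.
  rewrite /= sub0r normrN gtr0_norm ?mulr_gt0//.
  rewrite mulrC -ltr_pdivlMr//; near: t; apply: nbhs_right_lt.
  by rewrite divr_gt0.
apply: cvg_trans; apply: near_eq_cvg; near=> t.
rewrite scaled_gamma_posE//; near: t; exact: nbhs_right_ge.
Unshelve. all: by end_near. Qed.

Lemma scaled_gamma_continuous b v T : 0 < v -> 0 < T ->
  {within `[0, T], continuous (scaled_gamma b v)}.
Proof.
move=> v0 T0.
have c x : 0 < x -> {for x, continuous (scaled_gamma b v)}.
  move=> x0; apply: differentiable_continuous; apply/derivable1_diffP.
  by have [] := is_derive_scaled_gamma b v0 x0.
apply/(continuous_within_itvP _ T0); split.
- by move=> x; rewrite in_itv/= => /andP[x0 _]; exact: c.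
- exact: scaled_gamma_cvg0.
- by apply: cvg_at_left_filter; exact: c.
Qed.

End gamma.

(** * Riemann-Stieltjes integration by parts *)
Section riemann_stieltjes.
Context {R : realType}.
Notation mu := (@lebesgue_measure R).
Implicit Types (P V g : R -> R) (x y : R).

(** V is the total variation from x. A single increment bound replaces the
    Jordan decomposition in the sequel: V and P + V are then nondecreasing. *)
Lemma bounded_variation_dominator P x y : x <= y -> bounded_variation x y P ->
  exists V, forall p q, x <= p -> p <= q -> q <= y -> `|P q - P p| <= V q - V p.
Proof.
move=> xy bv; exists (fun r => fine (total_variation x r P)) => p q xp pq qy.
have xq : x <= q by exact: le_trans pq.
have fq : total_variation x q P \is a fin_num.
  by apply/bounded_variationP => //; exact: bounded_variationl bv.
have fp : total_variation x p P \is a fin_num.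
  apply/bounded_variationP => //; apply: bounded_variationl bv => //.
  exact: le_trans qy.
have := total_variationD P xp pq.
move: fq fp.
have := total_variation_ge P pq.
case: (total_variation x q P) => // r; case: (total_variation x p P) => // r'.
case: (total_variation p q P) => [r''| |]//; rewrite lee_fin => h _ _ [->]/=.
by rewrite [leRHS](_ : _ = r'') //; ring.
Qed.

(** Clamping the argument to [x, y] makes V monotone on the whole line. *)
Let measurable_of_monotone x y V :
  (forall p q, x <= p -> p <= q -> q <= y -> V p <= V q) -> x <= y ->
  measurable_fun `[x, y] V.
Proof.
move=> mV xy.
pose c r := Num.max x (Num.min r y).
have mc : {homo (V \o c) : m n / m <= n}.
  move=> m n mn; apply: mV; rewrite /c.
  - by rewrite le_max lexx.
  - rewrite ge_max le_max lexx/= le_max; apply/orP; right.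
    by rewrite le_min !ge_min mn lexx orbT.
  - by rewrite ge_max xy ge_min lexx orbT.
have : measurable_fun `[x, y] (V \o c) by exact: nondecreasing_measurable.
apply: eq_measurable_fun => r; rewrite inE/= in_itv/= => /andP[xr ry].
by rewrite /c (min_idPl ry) (max_idPr xr).
Qed.

Lemma bounded_variation_mfun P x y : x <= y -> bounded_variation x y P ->
  bounded_mfun x y P.
Proof.
move=> xy /(bounded_variation_dominator xy)[V PV]; split.
  have -> : P = (P \+ V) \- V by apply/funext => r /=; rewrite addrK.
  apply: measurable_funB; apply: measurable_of_monotone => //= p q xp pq qy.
    by have := PV p q xp pq qy; rewrite ler_norml => /andP[]; lra.
  by have := le_trans (normr_ge0 _) (PV p q xp pq qy); lra.
exists (`|P x| + (V y - V x)) => r /andP[xr ry].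
have -> : P r = P x + (P r - P x) by rewrite addrC subrK.
rewrite (le_trans (ler_normD _ _))// lerD2l (le_trans (PV x r _ _ _))// lerD2r.
by have := le_trans (normr_ge0 _) (PV r y xr ry (lexx _)); lra.
Qed.

(** The value of J is known as soon as Riemann-Stieltjes sums over arbitrarily
    fine partitions are. For the right endpoint as tag, the contribution of a
    piece [p, q] differs from the right-hand side for [p, q] by the integral of
    (P - P p) g' over [p, q], which is at most B (q - p) (V q - V p) with B a bound
    of g'. Over a uniform partition of step h these errors add up to
    B h (V y - V x). *)
Lemma RS_integral_by_parts P g (g' : R -> R) x y (J : R) : x < y ->
  bounded_variation x y P ->
  continuous g' -> (forall r : R, is_derive r 1 g (g' r)) ->
  is_RS_integral g P x y J ->
  J = g y * P y - g x * P x - \int[mu]_(r in `[x, y]) (P r * g' r).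
Proof.
move=> xy bv cg' dg HJ.
have xley := ltW xy.
have [V PV] := bounded_variation_dominator xley bv.
have bP := bounded_variation_mfun xley bv.
have bg' : bounded_mfun x y g'.
  by apply: continuous_bounded_mfun; exact: continuous_subspaceT.
have bPg := bounded_mfunM bP bg'.
have [_ [B g'B]] := bg'.
have B0 : 0 <= B by rewrite (le_trans _ (g'B x _))// lexx.
have V0 : 0 <= V y - V x by rewrite (le_trans _ (PV x y _ _ _))// ltW.
have cg : continuous g.
  by move=> r; apply: differentiable_continuous; apply/derivable1_diffP; have [] := dg r.
pose Z p q := g q * P q - g p * P p - \int[mu]_(r in `[p, q]) (P r * g' r).
have piece p q : x <= p -> p <= q -> q <= y ->
    `|g q * (P q - P p) - Z p q| <= B * (q - p) * (V q - V p).
  move=> xp pq qy.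
  have gE : g q - g p = \int[mu]_(r in `[p, q]) g' r.
    by rewrite (@Rintegral_FTC R g)//; exact: continuous_subspaceT.
  have bg'pq : bounded_mfun p q g' by apply: bounded_mfunS bg'.
  have bPpq : bounded_mfun p q (fun r => P r * g' r) by apply: bounded_mfunS bPg.
  have bcg : bounded_mfun p q (fun r => P p * g' r).
    by apply: bounded_mfunM => //; exact: bounded_mfun_cst.
  have -> : g q * (P q - P p) - Z p q =
      \int[mu]_(r in `[p, q]) (P r * g' r - P p * g' r).
    rewrite RintegralB//=; [|exact: bounded_mfun_integrable..].
    by rewrite RintegralZl//=; [rewrite -gE /Z; ring|exact: bounded_mfun_integrable].
  rewrite mulrAC.
  apply: norm_Rintegral_le => //; first exact: bounded_mfunB.
  move=> r /andP[pr rq]; rewrite -mulrBl normrM mulrC.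
  have rx : x <= r by exact: le_trans pr.
  have ry : r <= y by exact: le_trans qy.
  rewrite ler_pM ?g'B ?rx//.
  rewrite (le_trans (PV p r xp pr ry))// lerD2r.
  by have := le_trans (normr_ge0 _) (PV r q rx rq qy); lra.
have Zadd p q r : x <= p -> p <= q -> q <= r -> r <= y -> Z p r = Z p q + Z q r.
  move=> xp pq qr ry; rewrite /Z (Rintegral_split pq qr); first by ring.
  by apply: bounded_mfunS bPg.
apply/eqP; rewrite -subr_eq0 -normr_le0; apply/ler_addgt0Pr => e e0; rewrite add0r.
have [d d0 Hd] := HJ _ (divr_gt0 e0 (ltr0n _ 2) : 0 < e / 2).
pose w := Num.min d (e / (2 * (B * (V y - V x) + 1))).
have BV0 : 0 <= B * (V y - V x) by rewrite mulr_ge0.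
have w0 : 0 < w by rewrite lt_min d0 divr_gt0//; lra.
have [n] : exists n : nat, (y - x) / w < n%:R.
  by exists (Num.truncn ((y - x) / w)).+1; exact: truncnS_gt.
move=> nw.
have n0 : 0 < n%:R :> R by apply: le_lt_trans nw; rewrite divr_ge0 ?ltW// subr_gt0.
pose h := (y - x) / n%:R.
have h0 : 0 < h by rewrite divr_gt0// subr_gt0.
have hw : h < w by rewrite /h ltr_pdivrMr// mulrC -ltr_pdivrMr.
pose u (i : nat) := x + i%:R * h.
have u0 : u 0%N = x by rewrite /u mul0r addr0.
have un : u n = y by rewrite /u /h mulrC divfK ?gt_eqF// addrC subrK.
have uS i : u i.+1 = u i + h by rewrite /u -natr1; ring.
have um i j : (i <= j)%N -> u i <= u j.
  by move=> ij; rewrite /u lerD2l ler_wpM2r ?(ltW h0)// ler_nat.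
pose l := mkseq (fun i => u i.+1) n.
have sl : size l = n by rewrite size_mkseq.
have nl i z : (i < n)%N -> nth z l i = u i.+1 by move=> ?; rewrite nth_mkseq.
have nxl i z : (i < n)%N -> nth z (x :: l) i = u i.
  by case: i => [_|i ?] /=; rewrite ?u0// nl// ltnW.
have lP : itv_partition x y l.
  split.
    apply/(pathP x) => i; rewrite sl => lin.
    by rewrite nl// nxl// uS ltrDl.
  have n1 : (0 < n)%N by rewrite -(ltr_nat R).
  rewrite (last_nth x) sl.
  have [m nm] : exists m, n = m.+1 by case: (n) n1 => // m _; exists m.
  rewrite [in X in nth _ _ X]nm /= nl; last by rewrite nm.
  by rewrite -nm un.
have hl i : (i < size l)%N ->
    nth x (x :: l) i <= u i.+1 <= nth x l i /\ nth x l i - nth x (x :: l) i < d.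
  rewrite sl => lin; rewrite nl// nxl//; split.
    by apply/andP; split => //; exact: um.
  by rewrite uS addrAC subrr add0r (lt_le_trans hw)// ge_min lexx.
have := Hd l (fun i => u i.+1) lP hl.
have -> : RS_sum g P x l (fun i => u i.+1) =
    \sum_(i < n) g (u i.+1) * (P (u i.+1) - P (u i)).
  rewrite /RS_sum -sl; apply: eq_bigr => i _.
  have lin : (i < n)%N by rewrite -sl.
  by rewrite nl// nxl.
set S := \sum_(i < n) _ => SJ.
have claim m : (m <= n)%N ->
    `|\sum_(i < m) g (u i.+1) * (P (u i.+1) - P (u i)) - Z x (u m)|
      <= B * h * (V (u m) - V x).
  elim: m => [_|m IH mn].
    rewrite big_ord0 u0 /Z set_itv1 Rintegral_set1 !subrr normr0.
    by rewrite mulr0.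
  have xum : x <= u m by rewrite -u0 um.
  have umm : u m <= u m.+1 by rewrite um.
  have umy : u m.+1 <= y by rewrite -un um.
  rewrite big_ord_recr/= (Zadd _ _ _ _ xum umm umy)//.
  have := IH (ltnW mn); have := piece _ _ xum umm umy.
  have -> : u m.+1 - u m = h by rewrite uS addrAC subrr add0r.
  move=> h1 h2.
  set A := \sum_(i < m) _ in h2 *; set D := g _ * _ in h1 *.
  rewrite (_ : A + D - _ = (A - Z x (u m)) + (D - Z (u m) (u m.+1))); last by ring.
  rewrite (le_trans (ler_normD _ _))//.
  rewrite (_ : B * h * _ = B * h * (V (u m) - V x) + B * h * (V (u m.+1) - V (u m))).
    by rewrite lerD.
  by ring.
have := claim n (leqnn n); rewrite un -/S => SZ.
have Bh : B * h * (V y - V x) <= e / 2.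
  apply: (@le_trans _ _ (w * (B * (V y - V x)))).
    by rewrite mulrAC mulrC ler_wpM2r// ltW.
  apply: (@le_trans _ _ (e / (2 * (B * (V y - V x) + 1)) * (B * (V y - V x)))).
    by rewrite ler_wpM2r// ge_min lexx orbT.
  set k := B * _ in BV0 *.
  have k1 : 0 < k + 1 by rewrite ltr_wpDl.
  rewrite (_ : _ * k = e / 2 * (k / (k + 1))); last by field; rewrite gt_eqF.
  rewrite ler_piMr//; first by rewrite divr_ge0// ltW.
  by rewrite ler_pdivrMr ?mul1r ?lerDl.
have -> : J - (g y * P y - g x * P x - \int[mu]_(r in `[x, y]) (P r * g' r))
   = (S - Z x y) - (S - J) by rewrite /Z; ring.
rewrite (le_trans (ler_normB _ _))// [leRHS]splitr lerD ?(ltW SJ)//.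
exact: le_trans Bh.
Qed.

End riemann_stieltjes.

(** * Differentiability of the Laplace-Stieltjes transform *)
Section laplace.
Context {R : realType}.
Notation mu := (@lebesgue_measure R).
Variables (P lap : R -> R).
Hypothesis Pbv : forall x y : R, 0 < x -> x < y -> bounded_variation x y P.
Hypothesis P0 : P x @[x --> 0^'+] --> (0 : R).
Hypothesis lapP : forall s : R, 0 < s -> is_laplace_stieltjes P s (lap s).

Let measurable_P : measurable_fun (`]0, +oo[ : set R) P.
Proof.
pose F (n : nat) : set R := `[n.+1%:R^-1, n.+2%:R]%classic.
have -> : (`]0, +oo[%classic : set R) = \bigcup_n F n.
  apply/seteqP; split => x; rewrite /F /= ?in_itv/=.
    rewrite andbT => x0.
    have /ltr_add_invr [n] := x0; rewrite add0r => nx.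
    have [m xm] : exists m : nat, x < m%:R by exists (Num.truncn x).+1; exact: truncnS_gt.
    exists (maxn n m) => //=; rewrite in_itv/=; apply/andP; split.
      rewrite (le_trans _ (ltW nx))// lef_pV2 ?posrE// ler_nat ltnS.
      exact: leq_maxl.
    rewrite (le_trans (ltW xm))// ler_nat.
    by rewrite (leq_trans (leq_maxr n m))// -addn2 leq_addr.
  move=> [n _]; rewrite /= !in_itv/= andbT => /andP[nx _].
  by rewrite (lt_le_trans _ nx)// invr_gt0.
apply/measurable_fun_bigcup => n; rewrite /F; first exact: measurable_itv.
have nn : n.+1%:R^-1 < n.+2%:R :> R.
  by rewrite (@le_lt_trans _ _ 1)// ?invf_le1 ?ler1n ?ltr1n.
by have [] := bounded_variation_mfun (ltW nn) (Pbv _ nn).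
Qed.

Let locally_bounded_P : locally_bounded P.
Proof.
move=> T.
move/cvgrPdist_lt : P0 => /(_ _ ltr01)[d /= d0 Hd].
have d20 : 0 < d / 2 by rewrite divr_gt0.
have [Td|dT] := ltP T d.
  exists 1 => t /andP[t0 tT]; have := Hd t.
  rewrite /= !sub0r !normrN gtr0_norm// => h; apply/ltW/h => //.
  exact: le_lt_trans Td.
have d2T : d / 2 < T by rewrite (lt_le_trans _ dT)// ltr_pdivrMr// ltr_pMr// ltr1n.
have [_ [M PM]] := bounded_variation_mfun (ltW d2T) (Pbv d20 d2T).
exists (Num.max 1 M) => t /andP[t0 tT].
have [td|dt] := ltP t d.
  rewrite le_max; apply/orP; left; have := Hd t.
  by rewrite /= !sub0r !normrN gtr0_norm// => h; apply/ltW/h.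
rewrite le_max PM ?orbT//; apply/andP; split => //.
by rewrite (le_trans _ dt)// ler_pdivrMr// ler_pMr// ler1n.
Qed.

Let bounded_mfun_P T : bounded_mfun 0 T P.
Proof. exact: locally_bounded_mfun. Qed.

Let bounded_mfun_e s a b : bounded_mfun a b (fun u : R => expR (- (s * u))).
Proof.
apply: continuous_bounded_mfun; apply: continuous_subspaceT.
exact: continuous_expR_decay.
Qed.

Let bounded_mfun_Pe s T : bounded_mfun 0 T (fun u => P u * expR (- (s * u))).
Proof. exact: bounded_mfunM. Qed.

Let Q s y := \int[mu]_(u in `[0, y]) (P u * expR (- (s * u))).
(** Integration by parts makes the Stieltjes integral of e^(- s u) dP(u) over
    [x, y] equal to m s y - m s x, and m s vanishes at 0+ because P does.
    Hence m s y tends to lap s as y -> +oo. *)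
Let m s y := expR (- (s * y)) * P y + s * Q s y.

Let RS_integral_eq s x y J : 0 < x -> x < y ->
  is_RS_integral (fun u => expR (- (s * u))) P x y J -> J = m s y - m s x.
Proof.
move=> x0 xy.
have dg (r : R) := is_derive_expR_decay s r.
have cg' : continuous (fun r : R => - s * expR (- (s * r))).
  by move=> r; apply: cvgM; [exact: cvg_cst|exact: continuous_expR_decay].
move/(RS_integral_by_parts xy (Pbv x0 xy) cg' dg) => ->.
have -> : \int[mu]_(r in `[x, y]) (P r * (- s * expR (- (s * r)))) =
   - s * (Q s y - Q s x).
  rewrite /Q (Rintegral_split (ltW x0) (ltW xy) (bounded_mfun_Pe s y)).
  rewrite addrC addKr -RintegralZl//=; first by apply: eq_Rintegral => r _; ring.
  by apply: bounded_mfun_integrable; apply: bounded_mfunS (bounded_mfun_Pe s y) => //; exact: ltW.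
by rewrite /m; ring.
Qed.

Let Q_cvg0 s : Q s x @[x --> 0^'+] --> (0 : R).
Proof.
have := @parameterized_integral_continuous R 0 1 (fun u => P u * expR (- (s * u))) ler01
  (bounded_mfun_integrable (bounded_mfun_Pe s 1)).
move/(continuous_within_itvP _ ltr01) => [_ + _].
by rewrite /parameterized_integral set_itv1 Rintegral_set1.
Qed.

Let m_cvg0 s : m s x @[x --> 0^'+] --> (0 : R).
Proof.
rewrite [X in _ --> X](_ : 0 = expR (- (s * 0)) * 0 + s * 0); last by rewrite !mulr0 addr0.
apply: cvgD; last by apply: cvgM; [exact: cvg_cst|exact: Q_cvg0].
apply: cvgM => //; apply: cvg_at_right_filter; exact: continuous_expR_decay.
Qed.

Let m_cvgy s : 0 < s -> m s y @[y --> +oo] --> lap s.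
Proof.
move=> s0; have [J HJ near_J] := lapP s0.
apply/cvgrPdist_le => e e0.
have e20 : 0 < e / 2 by rewrite divr_gt0.
have [[A B] /= [A0 By] H] := near_J _ e20.
apply: filterS2 By (nbhs_pinfty_gt (num_real 1)) => y By y1.
apply/ler_addgt0Pr => d dd0.
have := m_cvg0 s => /cvgrPdist_lt /(_ _ dd0) md.
near (0:R)^'+ => x.
have Ax : A x by near: x.
have x0 : 0 < x by near: x; exact: nbhs_right_gt.
have x1 : x < 1 by near: x; exact: nbhs_right_lt.
have xy : x < y by exact: lt_trans y1.
have mx : `|0 - m s x| < d by near: x.
have := H (x, y) (conj Ax By); rewrite /= (RS_integral_eq x0 xy (HJ _ _ x0 xy)) => h.
rewrite sub0r normrN in mx.
have -> : lap s - m s y = - (m s y - m s x - lap s) - m s x by ring.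
rewrite (le_trans (ler_normB _ _))// normrN lerD ?(ltW mx)//.
by rewrite (le_trans (ltW h))// ler_pdivrMr// ler_peMr ?ltW// ltr1n.
Unshelve. all: by end_near. Qed.

Let m_bounded s : 0 < s -> exists2 M, 0 < M & forall y, 0 < y -> `|m s y| <= M.
Proof.
move=> s0; have /cvgrPdist_lt/(_ _ ltr01)[Y [_ HY]] := m_cvgy s0.
pose Z := Num.max (Y + 1) 1.
have Z1 : 1 <= Z by rewrite le_max lexx orbT.
have [_ [B PB]] := bounded_mfun_Pe s Z.
have B0 : 0 <= B by rewrite (le_trans _ (PB 0 _))// lexx; lra.
exists (Num.max (`|lap s| + 1) (B + s * (B * Z)) + 1).
  by rewrite ltr_wpDl// le_max addr_ge0.
move=> y y0; apply: ler_wpDr => //.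
have [Zy|yZ] := ltP Z y.
  rewrite le_max; apply/orP; left.
  have Yy : Y < y by rewrite (lt_trans _ Zy)// lt_max ltrDl ltr01.
  have := HY y Yy; rewrite distrC => /ltW h.
  rewrite -[m s y](subrK (lap s)) (le_trans (ler_normD _ _))// addrC lerD2l //.
rewrite le_max; apply/orP; right.
rewrite /m (le_trans (ler_normD _ _))// lerD//.
  by rewrite mulrC PB// (ltW y0).
rewrite normrM gtr0_norm// ler_wpM2l ?(ltW s0)//.
apply: (@le_trans _ _ (B * (y - 0))).
  apply: norm_Rintegral_le; first exact: ltW.
    exact: bounded_mfun_Pe.
  by move=> r /andP[r0 ry]; apply: PB; rewrite r0 (le_trans ry).
by rewrite subr0 ler_wpM2l.
Qed.

(** Boundedness of m s' is a Gronwall inequality for p(u) = P u e^(- s' u), namely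
    |p(y)| <= M + s' int_0^y |p|. Let S be the supremum of |p(u)| e^(- 2 s' u) on
    ]0, y], finite since P is locally bounded. Inserting
    |p(u)| <= S e^(2 s' u) gives S <= M + S / 2, hence S <= 2 M and
    |P u| <= 2 M e^(3 s' u). As s' is arbitrary, so is s = 3 s'. *)
Let P_growth s : 0 < s ->
  exists2 C, 0 <= C & forall y, 0 <= y -> `|P y| <= C * expR (s * y).
Proof.
move=> s30; pose s' := s / 3.
have s0 : 0 < s' by rewrite divr_gt0.
have sE : s = 3 * s' by rewrite /s' mulrC divfK.
have [M M0 mM] := m_bounded s0.
have main y : 0 < y -> `|P y| <= 2 * M * expR (s * y).
  move=> y0.
  pose A := [set `|P r * expR (- (s * r))| | r in `]0, y]].
  have [_ [B PB]] := bounded_mfun_Pe s y.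
  have supA : has_sup A.
    split; first by exists `|P y * expR (- (s * y))|, y => //=; rewrite in_itv/= y0 lexx.
    exists B => _ [r /= + <-]; rewrite in_itv/= => /andP[r0 ry].
    by apply: PB; rewrite (ltW r0).
  pose S := sup A.
  have AS r : 0 < r <= y -> `|P r * expR (- (s * r))| <= S.
    by move=> ry; apply: ub_le_sup => //; [exact: supA.2|exists r].
  have S0 : 0 <= S by rewrite (le_trans _ (AS y _)) ?y0 ?lexx.
  have SM : S <= M + S / 2.
    apply: ge_sup; first exact: supA.1.
    move=> _ [r /= + <-]; rewrite in_itv/= => /andP[r0 ry].
    have e2 := expR_gt0 (2 * s' * r).
    have -> : P r * expR (- (s * r)) = (expR (- (s' * r)) * P r) / expR (2 * s' * r).
      rewrite -expRN [RHS]mulrAC [RHS]mulrC -expRD; congr (_ * expR _).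
      by rewrite sE; ring.
    have -> : expR (- (s' * r)) * P r = m s' r - s' * Q s' r by rewrite /m addrK.
    rewrite normrM normfV (gtr0_norm e2) ler_pdivrMr//.
    rewrite (le_trans (ler_normB _ _))//.
    have QS : `|s' * Q s' r| <= S / 2 * expR (2 * s' * r).
      pose F u : R := S / 2 * expR (- (- (2 * s') * u)).
      have dF (u : R) : is_derive u 1 F (S * s' * expR (- (- (2 * s') * u))).
        have -> : F = (S / 2) *: (fun u => expR (- (- (2 * s') * u))) by [].
        rewrite (_ : S * s' * _ = (S / 2) *: (- - (2 * s') * expR (- (- (2 * s') * u)))).
          by apply: is_deriveZ; exact: is_derive_expR_decay.
        by rewrite /GRing.scale/=; field.
      have cD : continuous (fun u => S * s' * expR (- (- (2 * s') * u))).
        by move=> u; apply: cvgM; [exact: cvg_cst|exact: continuous_expR_decay].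
      have bD : bounded_mfun 0 r (fun u => S * s' * expR (- (- (2 * s') * u))).
        by apply: continuous_bounded_mfun; exact: continuous_subspaceT.
      have : \int[mu]_(u in `[0, r]) (S * s' * expR (- (- (2 * s') * u))) = F r - F 0.
        rewrite (@Rintegral_FTC R F)//; [exact: ltW|exact: continuous_subspaceT|].
        apply: continuous_subspaceT => u; apply: differentiable_continuous.
        by apply/derivable1_diffP; have [] := dF u.
      move=> FE.
      rewrite normrM gtr0_norm//.
      have iPe : mu.-integrable `[0, r] (EFin \o (fun u => P u * expR (- (s' * u)))).
        exact: bounded_mfun_integrable.
      apply: (@le_trans _ _ (s' * \int[mu]_(u in `]0, r]) `|P u * expR (- (s' * u))|)).
        rewrite ler_wpM2l ?(ltW s0)// /Q -Rintegral_itv_obnd_cbnd; last first.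
          by apply: (@integrableS _ _ _ mu `[0, r]) => //; apply: subset_itvr; rewrite bnd_simp.
        apply: le_normr_Rintegral => //.
        by apply: (@integrableS _ _ _ mu `[0, r]) => //; apply: subset_itvr; rewrite bnd_simp.
      have iD : mu.-integrable `]0, r] (EFin \o (fun u => S * s' * expR (- (- (2 * s') * u)))).
        by apply: (@integrableS _ _ _ mu `[0, r]) => //;
          [apply: subset_itvr; rewrite bnd_simp|exact: bounded_mfun_integrable].
      apply: (@le_trans _ _ (F r - F 0)); last first.
        rewrite /F !mulNr !opprK lerBlDr lerDl.
        by rewrite mulr_ge0 ?expR_ge0 ?divr_ge0.
      rewrite -FE -Rintegral_itv_obnd_cbnd//.
      rewrite -RintegralZl//; last first.
        apply: (@integrableS _ _ _ mu `[0, r]) => //.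
          by apply: subset_itvr; rewrite bnd_simp.
        apply: (bounded_mfun_integrable (f := fun u => `|P u * expR (- (s' * u))|)).
        have [mf [B' PB']] := bounded_mfun_Pe s' r.
        split; first exact: measurableT_comp.
        by exists B' => u ur; rewrite normr_id PB'.
      apply: le_Rintegral => //.
        apply: (@integrableS _ _ _ mu `[0, r]) => //.
          by apply: subset_itvr; rewrite bnd_simp.
        apply: (bounded_mfun_integrable (f := fun u => s' * `|P u * expR (- (s' * u))|)).
        apply: bounded_mfunM; first exact: bounded_mfun_cst.
        have [mf [B' PB']] := bounded_mfun_Pe s' r.
        split; first exact: measurableT_comp.
        by exists B' => u ur; rewrite normr_id PB'.
      move=> u; rewrite /= in_itv/= => /andP[u0 ur].
      rewrite [leRHS]mulrC mulrA [leRHS]mulrC ler_wpM2l ?(ltW s0)//.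
      have := AS u; rewrite u0 (le_trans ur ry) => /(_ isT).
      rewrite !normrM !(gtr0_norm (expR_gt0 _)) => h.
      rewrite mulNr opprK.
      have -> : - (s' * u) = 2 * s' * u + - (s * u) by rewrite sE; ring.
      by rewrite expRD mulrCA mulrC [leRHS]mulrC ler_wpM2l ?expR_ge0// mulrC.
    rewrite mulrDl lerD//.
    apply: (le_trans (mM r r0)); rewrite ler_peMr ?(ltW M0)//.
    by rewrite -expR0 ler_expR !mulr_ge0 ?ltW.
  have := AS y; rewrite y0 lexx => /(_ isT).
  rewrite normrM (gtr0_norm (expR_gt0 _)) expRN ler_pdivrMr ?expR_gt0// => h.
  apply: (le_trans h); rewrite ler_wpM2r ?expR_ge0//; lra.
exists (2 * M + `|P 0|); first by rewrite addr_ge0// ltW// mulr_gt0.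
move=> y; rewrite le_eqVlt => /predU1P[<-|y0].
  by rewrite mulr0 expR0 mulr1 lerDr mulr_ge0// ltW.
by rewrite (le_trans (main y y0))// ler_wpM2r ?expR_ge0// lerDl.
Qed.

Let measurable_Pe s : measurable_fun (`[0, +oo[ : set R) (fun u => P u * expR (- (s * u))).
Proof.
apply: measurable_funM; last first.
  by apply: measurable_funTS; apply: continuous_measurable_fun; exact: continuous_expR_decay.
rewrite -(@setU1itv _ R (BInfty _ false) 0 false)//.
by apply/measurable_funU => //; split => //; exact: measurable_fun_set1.
Qed.

Let Pe_bound s e : 0 < e -> exists2 C, 0 <= C &
  forall s' u, s <= s' -> 0 <= u -> `|P u * expR (- (s' * u))| <= C * expR (- ((s - e) * u)).
Proof.
move=> e0; have [C C0 PC] := P_growth e0; exists C => // s' u ss' u0.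
rewrite normrM (gtr0_norm (expR_gt0 _)).
have -> : - ((s - e) * u) = e * u + - (s * u) by ring.
rewrite expRD mulrA ler_pM ?expR_ge0 ?PC// ler_expR lerN2.
by rewrite ler_wpM2r.
Qed.

Let integrable_Pe s : 0 < s ->
  mu.-integrable `[0, +oo[ (EFin \o (fun u => P u * expR (- (s * u)))).
Proof.
move=> s0; have s20 : 0 < s / 2 by rewrite divr_gt0.
have [C C0 PC] := Pe_bound s s20.
have : mu.-integrable `[0, +oo[ (fun u => (C%:E * (expR (- ((s / 2) * u)))%:E)%E).
  by apply: integrableZl => //; exact: integrable_expR_decay.
apply: le_integrable => //.
  by apply/measurable_EFinP; exact: measurable_Pe.
move=> u; rewrite /= in_itv/= andbT => u0.
rewrite lee_fin [leRHS]ger0_norm ?mulr_ge0 ?expR_ge0//.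
by have := PC s u (lexx _) u0; rewrite {2}(splitr s) addrK.
Qed.

Let Rintegral_expR_decay b y : 0 < b ->
  \int[mu]_(u in `[y, +oo[) expR (- (b * u)) = expR (- (b * y)) / b.
Proof.
move=> b0; pose F u := - b^-1 * expR (- (b * u)).
have dF (u : R) : is_derive u 1 F (expR (- (b * u))).
  have -> : F = (- b^-1) *: (fun u => expR (- (b * u))) by [].
  rewrite (_ : expR _ = (- b^-1) *: (- b * expR (- (b * u)))).
    by apply: is_deriveZ; exact: is_derive_expR_decay.
  by rewrite /GRing.scale/= mulrA mulrNN mulVf ?mul1r// gt_eqF.
have cF : continuous F.
  by move=> u; apply: differentiable_continuous; apply/derivable1_diffP; have [] := dF u.
rewrite (@Rintegral_ge0_continuous_FTC2y R _ F y 0).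
- by rewrite /F sub0r mulNr opprK mulrC.
- by move=> u _; exact: expR_ge0.
- by apply: continuous_subspaceT; exact: continuous_expR_decay.
- rewrite [X in _ --> X](_ : 0 = - b^-1 * 0); last by rewrite mulr0.
  apply: cvgM; first exact: cvg_cst.
  apply: (@cvg_comp _ _ _ (fun u => b * u) (fun u => expR (- u)) _ (+oo%R)).
    exact: gt0_cvgMry.
  exact: cvgr_expR.
- by move=> u _; have [] := dF u.
- by apply: cvg_at_right_filter; exact: cF.
- by move=> u _; have [_ <-] := dF u; rewrite derive1E.
Qed.

(** In m s y = e^(- s y) P y + s int_0^y e^(- s u) P u du, the growth bound with
    rate s / 2 makes the first term vanish as y -> +oo and the integral converge
    absolutely. *)
Let laplace_integral s : 0 < s ->
  lap s = s * \int[mu]_(u in `[0, +oo[) (P u * expR (- (s * u))).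
Proof.
move=> s0; have s20 : 0 < s / 2 by rewrite divr_gt0.
have [C C0 PC] := Pe_bound s s20.
have {}PC u : 0 <= u -> `|P u * expR (- (s * u))| <= C * expR (- ((s / 2) * u)).
  by move=> u0; have := PC s u (lexx _) u0; rewrite {2}(splitr s) addrK.
set I := \int[mu]_(u in _) _.
have ie := integrable_expR_decay s20.
have IQ y : 0 <= y -> `|I - Q s y| <= C * (expR (- ((s / 2) * y)) / (s / 2)).
  move=> y0.
  have sub : (`]y, +oo[ : set R) `<=` `[0, +oo[.
    by apply: subset_itvr; rewrite bnd_simp.
  have sub' : (`[y, +oo[ : set R) `<=` `[0, +oo[.
    by apply: subset_itvr; rewrite bnd_simp.
  have iey : mu.-integrable `[y, +oo[ (EFin \o (fun u => expR (- (s / 2 * u)))).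
    by apply: (@integrableS _ _ _ mu `[0, +oo[).
  have iCey : mu.-integrable `[y, +oo[ (EFin \o (fun u => C * expR (- (s / 2 * u)))).
    have : mu.-integrable `[y, +oo[ (fun u => (C%:E * (expR (- (s / 2 * u)))%:E)%E).
      exact: integrableZl.
    by [].
  have iPy : mu.-integrable `]y, +oo[ (EFin \o (fun u => P u * expR (- (s * u)))).
    by apply: (@integrableS _ _ _ mu `[0, +oo[) => //; exact: integrable_Pe.
  have := Rintegral_itvB (integrable_Pe s0) (x := y); rewrite !bnd_simp => /(_ y0 isT).
  rewrite -/I -/(Q s y) => ->.
  rewrite -Rintegral_expR_decay// -RintegralZl//.
  rewrite -[leRHS]Rintegral_itv_obnd_cbnd; last first.
    apply: (@integrableS _ _ _ mu `[y, +oo[) => //.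
      by apply: subset_itvr; rewrite bnd_simp.
  apply: (le_trans (le_normr_Rintegral _ iPy)) => //.
  apply: le_Rintegral => //.
  - have : mu.-integrable `]y, +oo[ (fun u => `|(P u * expR (- (s * u)))%:E|%E).
      exact: integrable_abse.
    by [].
  - apply: (@integrableS _ _ _ mu `[y, +oo[) => //.
      by apply: subset_itvr; rewrite bnd_simp.
  - move=> u; rewrite /= in_itv/= andbT => yu; apply: PC.
    by rewrite (le_trans y0)// ltW.
have e_cvg : expR (- ((s / 2) * y)) @[y --> +oo] --> (0 : R).
  apply: (@cvg_comp _ _ _ (fun u => (s / 2) * u) (fun u => expR (- u)) _ (+oo%R)).
    exact: gt0_cvgMry.
  exact: cvgr_expR.
have m_cvgI : m s y @[y --> +oo] --> s * I.
  apply/cvgrPdist_le => eps eps0.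
  have K0 : 0 < C * (1 + s / (s / 2)) + 1.
    by rewrite ltr_wpDl// mulr_ge0// addr_ge0// divr_ge0// ltW.
  move/cvgrPdist_lt : e_cvg => /(_ _ (divr_gt0 eps0 K0)) He.
  apply: filterS2 He (nbhs_pinfty_ge (num_real 0)) => y He y0.
  rewrite sub0r normrN (gtr0_norm (expR_gt0 _)) ltr_pdivlMr// in He.
  have -> : s * I - m s y = s * (I - Q s y) - P y * expR (- (s * y)) by rewrite /m; ring.
  rewrite (le_trans (ler_normB _ _))// normrM gtr0_norm//.
  apply: (@le_trans _ _ (s * (C * (expR (- ((s / 2) * y)) / (s / 2)))
      + C * expR (- ((s / 2) * y)))).
    by rewrite lerD ?PC// ler_wpM2l ?(ltW s0)// IQ.
  rewrite (le_trans _ (ltW He))//.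
  set E := expR _.
  rewrite (_ : _ + _ = E * (C * (1 + s / (s / 2)))); last by ring.
  by rewrite ler_wpM2l ?expR_ge0// lerDl.
exact: cvg_unique (m_cvgy s0) m_cvgI.
Qed.

(** Near s the derivative of the integrand, - u e^(- x u) P u, is dominated for
    x > s / 2 by a multiple of e^(- s u / 4): the growth bound with rate s / 8
    absorbs P, and u <= e^(s u / 8) / (s / 8) absorbs the factor u. *)
Lemma laplace_derivable s : 0 < s -> derivable lap s 1.
Proof.
move=> s0.
pose L x := \int[mu]_(u in `[0, +oo[) (P u * expR (- (x * u))).
pose e := s / 8.
have e0 : 0 < e by rewrite divr_gt0.
have [C C0 PC] := Pe_bound (s / 2) e0.
have dfe (x u : R) : is_derive x 1 (fun x => P u * expR (- (x * u)))
    (P u * (- u * expR (- (x * u)))).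
  have -> : (fun x => P u * expR (- (x * u))) = P u *: (fun x => expR (- (u * x))).
    by apply/funext => z; rewrite !fctE /GRing.scale/= (mulrC u).
  rewrite (mulrC x).
  by apply: (@is_deriveZ R R R); exact: is_derive_expR_decay.
have dL : derivable L s 1.
  apply: (@derivable_under_integral R _ _ mu (fun x u => P u * expR (- (x * u))) `[0, +oo[
     (measurable_itv _) s (s / 2) (2 * s) _ _ _
     (fun u => C / e * expR (- ((s / 4) * u)))).
  - by rewrite /= in_itv/=; lra.
  - by move=> x; rewrite /= in_itv/= => sx; apply: integrable_Pe; lra.
  - by move=> x u _ _; have [] := dfe x u.
  - by move=> u; rewrite mulr_ge0 ?expR_ge0// divr_ge0// ltW.
  - have : mu.-integrable `[0, +oo[ (fun u => ((C / e)%:E * (expR (- (s / 4 * u)))%:E)%E).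
      by apply: integrableZl => //; apply: integrable_expR_decay; lra.
    by [].
  - move=> x u; rewrite /= !in_itv/= andbT => /andP[sx _] u0.
    rewrite partial1of2E; have [_ ->] := dfe x u.
    rewrite mulNr mulrN normrN mulrCA normrM (ger0_norm u0).
    have ue : u <= e^-1 * expR (e * u).
      rewrite -ler_pdivrMl ?invr_gt0// invrK.
      by have := expR_ge1Dx (e * u); lra.
    apply: (le_trans (ler_pM _ _ ue (PC x u (ltW sx) u0))) => //.
    have -> : - (s / 4 * u) = e * u + - ((s / 2 - e) * u) by rewrite /e; field.
    by rewrite expRD le_eqVlt; apply/orP; left; apply/eqP; ring.
have dlap : derivable (id * L) s 1.
  by apply: derivableM; [exact: derivable_id|exact: dL].
apply: near_eq_derivable dlap => //.
near=> x; rewrite laplace_integral//=; near: x; exact: lt_nbhsr.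
Unshelve. all: by end_near. Qed.

End laplace.

(** * Characteristics *)
Section characteristics.
Context {R : realType}.
Notation mu := (@lebesgue_measure R).
Variables (a b c v : R).
Hypotheses (a0 : 0 < a) (v0 : 0 < v).
Notation g := (scaled_gamma b v).
Implicit Types (t x s k T : R).

(** The characteristic of parameter k is defined as long as a g(t) + k > 0. *)
Definition characteristic t k : R := expR (- (b * t)) / (a * g t + k).
Definition damping t k : R := \int[mu]_(x in `[0, t]) G_integrand a b c v k x.

Lemma scaled_gamma_nonincreasing x t : 0 <= x -> x <= t -> g t <= g x.
Proof.
move=> x0; rewrite le_eqVlt => /predU1P[->//|xt].
have cg : {within `[x, t], continuous g}.
  apply: continuous_subspaceW (scaled_gamma_continuous v0 (le_lt_trans x0 xt)).
  by apply: subset_itvr; rewrite bnd_simp.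
have dg y : y \in `]x, t[ -> is_derive y 1 g (- (y `^ (2 * v - 1) * expR (- (b * y)))).
  rewrite in_itv/= => /andP[xy _]; apply: is_derive_scaled_gamma => //.
  exact: le_lt_trans xy.
have [y _ E] := MVT_segment (ltW xt) dg cg.
rewrite -subr_le0 E mulNr oppr_le0 !mulr_ge0 ?powR_ge0 ?expR_ge0//.
by rewrite subr_ge0 ltW.
Qed.

(** g is nonincreasing, so a characteristic defined at time t is defined at all
    earlier times. *)
Lemma characteristic_dom_le x t k : 0 <= x -> x <= t -> 0 < a * g t + k -> 0 < a * g x + k.
Proof.
move=> x0 xt h; apply: (lt_le_trans h); rewrite lerD2r ler_wpM2l ?(ltW a0)//.
exact: scaled_gamma_nonincreasing.
Qed.

Lemma KE t s : 0 < s -> K a b v t s = expR (- (b * t)) / s - a * g t.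
Proof.
move=> s0; rewrite /K expRN; field.
by rewrite (gt_eqF s0) gt_eqF ?expR_gt0.
Qed.

Lemma K_in_dom t s : 0 < s -> 0 < a * g t + K a b v t s.
Proof. by move=> s0; rewrite KE// addrC subrK divr_gt0 ?expR_gt0. Qed.

Lemma characteristic_K t s : 0 < s -> characteristic t (K a b v t s) = s.
Proof.
move=> s0; rewrite /characteristic KE// [_ + (_ - _)]addrC subrK invfM invrK mulrA.
by rewrite mulfV ?mul1r// gt_eqF ?expR_gt0.
Qed.

Lemma K_characteristic t k : 0 < a * g t + k -> K a b v t (characteristic t k) = k.
Proof.
move=> h; rewrite KE ?divr_gt0 ?expR_gt0// /characteristic invfM invrK mulrA.
by rewrite mulfV ?gt_eqF ?expR_gt0// mul1r addrAC subrr add0r.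
Qed.

Lemma characteristic_gt0 t k : 0 < a * g t + k -> 0 < characteristic t k.
Proof. by move=> h; rewrite divr_gt0 ?expR_gt0. Qed.

Lemma G_integrandE k : G_integrand a b c v k =
  (fun x => c * expR (- (b * x)) / (a * g x + k)).
Proof.
apply/funext => x; rewrite /G_integrand (mulrC (expR _) k) -mulrDl invfM expRN.
by rewrite mulrAC mulrA.
Qed.

Lemma G_integrand_characteristic k t : G_integrand a b c v k t = c * characteristic t k.
Proof. by rewrite G_integrandE /characteristic mulrA. Qed.

Let cg T : 0 < T -> {within `[0, T], continuous (fun x => a * g x)}.
Proof.
by move=> T0 x; apply: cvgM; [exact: cvg_cst|exact: scaled_gamma_continuous].
Qed.

Lemma expands_at_G_integrand T k : 0 < T -> 0 < a * g T + k ->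
  expands_at T (fun x k => G_integrand a b c v k x) k
   (fun x => - (c * expR (- (b * x)) / (a * g x + k) ^+ 2)).
Proof.
move=> T0 h.
rewrite (_ : (fun x k => _) = (fun x k => c * expR (- (b * x)) / (a * g x + k))); last first.
  by apply/funext => x; apply/funext => k'; rewrite G_integrandE.
apply: expands_at_div; first exact: ltW.
- apply: continuous_subspaceT => x; apply: cvgM; first exact: cvg_cst.
  exact: continuous_expR_decay.
- exact: cg.
- by move=> x /andP[x0 xT]; exact: characteristic_dom_le h.
Qed.

Lemma expands_at_damping T k : 0 < T -> 0 < a * g T + k ->
  exists e', expands_at T damping k e'.
Proof.
move=> T0 h.
have := expands_at_integral (ltW T0) (bounded_mfun_cst 0 T 1) (expands_at_G_integrand T0 h).
rewrite (_ : (fun t k => \int[mu]_(x in `[0, t]) (1 * G_integrand a b c v k x)) = damping).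
  by move=> ?; eexists; eassumption.
by apply/funext => t; apply/funext => k'; apply: eq_Rintegral => x _; rewrite mul1r.
Qed.

(** Room to the right of t, so that t is interior to a segment on which the
    expansions in k are available. *)
Lemma characteristic_dom_extend t k : 0 < t -> 0 < a * g t + k ->
  exists2 T, t < T & 0 < a * g T + k.
Proof.
move=> t0 h.
have [dg _] := is_derive_scaled_gamma b v0 t0.
have ct : {for t, continuous (fun x => a * g x + k)}.
  apply: cvgD; last exact: cvg_cst.
  apply: cvgM; first exact: cvg_cst.
  by apply: differentiable_continuous; apply/derivable1_diffP.
near t^'+ => T; exists T; first by near: T; exact: nbhs_right_gt.
by near: T; apply: (cvgr_gt _ (cvg_at_right_filter ct)).
Unshelve. all: by end_near. Qed.

Lemma continuous_G_integrand T k : 0 < T -> 0 < a * g T + k ->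
  {within `[0, T], continuous (G_integrand a b c v k)}.
Proof. by move=> T0 h; exact: expands_at_continuous (expands_at_G_integrand T0 h). Qed.

Lemma is_derive_damping t k : 0 < t -> 0 < a * g t + k ->
  is_derive t 1 (damping ^~ k) (c * characteristic t k).
Proof.
move=> t0 h; have [T tT hT] := characteristic_dom_extend t0 h.
have T0 := lt_trans t0 tT.
have cG := continuous_G_integrand T0 hT.
rewrite -G_integrand_characteristic; apply: (@is_derive_Rintegral_continuous _ _ _ _ T) => //.
  by apply: bounded_mfun_integrable; exact: continuous_bounded_mfun.
by have [+ _ _] := (continuous_within_itvP _ T0).1 cG; apply; rewrite in_itv/= t0.
Qed.

Lemma damping_continuous T k : 0 < T -> 0 < a * g T + k ->
  {within `[0, T], continuous (damping ^~ k)}.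
Proof.
by move=> T0 h; have [e' /expands_at_continuous] := expands_at_damping T0 h.
Qed.

Lemma is_derive_characteristic t k : 0 < t -> 0 < a * g t + k ->
  is_derive t 1 (characteristic ^~ k)
    (characteristic t k * (a * t `^ (2 * v - 1) * characteristic t k - b)).
Proof.
move=> t0 h.
have N0 : a * g t + k != 0 by rewrite gt_eqF.
have d1 : is_derive t 1 (fun x => a * g x + k)
    (a *: (- (t `^ (2 * v - 1) * expR (- (b * t)))) + 0).
  apply: is_deriveD; apply: is_deriveZ; exact: is_derive_scaled_gamma.
have d2 := is_derive_expR_decay b t.
have d3 : is_derive t 1 (fun x => (a * g x + k)^-1)
    (- (a * g t + k) ^- 2 *: (a *: (- (t `^ (2 * v - 1) * expR (- (b * t)))) + 0)).
  exact: (@is_deriveV R (fun x => a * g x + k)).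
have d4 : is_derive t 1 (characteristic ^~ k) _ := is_deriveM d2 d3.
apply: (is_derive_eq d4).
rewrite /characteristic /GRing.scale/=; field.
by rewrite N0.
Qed.

(** As t -> 0 with s fixed the parameter K(t, s) moves, so the smallness of the
    integrals over [0, t] needs a bound that does not mention the parameter. *)
Lemma G_integrand_K_le t s x : 0 < s -> 0 <= x -> x <= t ->
  `|G_integrand a b c v (K a b v t s) x| <= `|c| * s * expR (`|b| * t).
Proof.
move=> s0 x0 xt; have t0 := le_trans x0 xt.
rewrite G_integrand_characteristic normrM -mulrA ler_wpM2l//.
have hx : 0 < a * g x + K a b v t s.
  by apply: characteristic_dom_le xt _ => //; exact: K_in_dom.
rewrite gtr0_norm ?characteristic_gt0// /characteristic ler_pdivrMr//.
apply: (@le_trans _ _ (s * expR (`|b| * t) * (expR (- (b * t)) / s))).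
  rewrite (_ : _ * (_ / s) = expR (`|b| * t) * expR (- (b * t))); last first.
    by field; rewrite gt_eqF.
  rewrite -expRD ler_expR -lerBlDr opprK addrC -mulrBr.
  rewrite (le_trans (ler_norm _))// normrM ler_wpM2l// ger0_norm ?subr_ge0//.
  by rewrite lerBlDr lerDl.
rewrite ler_wpM2l// ?mulr_ge0 ?expR_ge0 ?(ltW s0)//.
have -> : expR (- (b * t)) / s = a * g t + K a b v t s.
  by rewrite KE// addrC subrK.
by rewrite lerD2r ler_wpM2l ?(ltW a0)// scaled_gamma_nonincreasing.
Qed.

Lemma damping_K_le t s x : 0 < s -> 0 < t -> 0 <= x -> x <= t ->
  `|damping x (K a b v t s)| <= `|c| * s * expR (`|b| * t) * t.
Proof.
move=> s0 t0 x0 xt.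
have cG := continuous_G_integrand t0 (K_in_dom t s0).
apply: (@le_trans _ _ (`|c| * s * expR (`|b| * t) * (x - 0))); last first.
  by rewrite subr0 ler_wpM2l// !mulr_ge0 ?expR_ge0// ltW.
apply: norm_Rintegral_le => //.
  by apply: bounded_mfunS (continuous_bounded_mfun cG).
by move=> y /andP[y0 yx]; apply: G_integrand_K_le => //; exact: le_trans xt.
Qed.

Lemma K_cvg0 s : 0 < s -> K a b v t s @[t --> 0^'+] --> s^-1 - a * g 0.
Proof.
move=> s0; under eq_fun do rewrite KE//.
apply: cvgB; last by apply: cvgM; [exact: cvg_cst|exact: scaled_gamma_cvg0].
rewrite -[X in _ --> X]mul1r; apply: cvgM; last exact: cvg_cst.
rewrite [X in _ --> X](_ : 1 = expR (- (b * 0))); last by rewrite mulr0 oppr0 expR0.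
apply: cvg_at_right_filter; exact: continuous_expR_decay.
Qed.

End characteristics.

(** * The solution formula *)
Section solution.
Context {R : realType}.
Notation mu := (@lebesgue_measure R).
Variables (a b c v : R) (lap f : R -> R).
Hypotheses (a0 : 0 < a) (v0 : 0 < v).
Hypothesis dlap : forall s : R, 0 < s -> derivable lap s 1.
Hypothesis mf : measurable_fun (`]0, +oo[ : set R) f.
Hypothesis lf : locally_bounded f.
Notation g := (scaled_gamma b v).
Notation Phi := (damping a b c v).
Notation S := (characteristic a b v).
Notation Kts := (K a b v).
Implicit Types (t x s k T : R).

Definition forcing t k : R := \int[mu]_(x in `[0, t]) (f x * expR (Phi x k)).
Definition evolution t k : R :=
  expR (- Phi t k) * (lap (a * g 0 + k)^-1 + forcing t k).

Let bf T : bounded_mfun 0 T f.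
Proof. exact: locally_bounded_mfun. Qed.

Let expands_at_forcing T k : 0 < T -> 0 < a * g T + k ->
  exists e', expands_at T forcing k e'.
Proof.
move=> T0 h; have [e' He] := expands_at_damping c a0 v0 T0 h.
eexists.
exact: (expands_at_integral (ltW T0) (bf T) (expands_at_expR (ltW T0) He)).
Qed.

Let expR_damping_continuous T k : 0 < T -> 0 < a * g T + k ->
  {within `[0, T], continuous (fun x => expR (Phi x k))}.
Proof.
move=> T0 h x; apply: continuous_comp; last exact: continuous_expR.
exact: damping_continuous.
Qed.

Let is_derive_forcing t k : 0 < t -> 0 < a * g t + k ->
  is_derive t 1 (fun x => \int[mu]_(y in `[0, x]) f y) (f t) ->
  is_derive t 1 (forcing ^~ k) (f t * expR (Phi t k)).
Proof.
move=> t0 h df; have [T tT hT] := characteristic_dom_extend v0 t0 h.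
apply: (is_derive_Rintegral_weight (T := T) _ (bf T)) => //.
  by rewrite t0.
by apply: expR_damping_continuous => //; exact: lt_trans tT.
Qed.

Let differentiable_damping t k : 0 < t -> 0 < a * g t + k ->
  differentiable (fun z : R * R => Phi z.1 z.2) (t, k).
Proof.
move=> t0 h; have [T tT hT] := characteristic_dom_extend v0 t0 h.
have [e' He] := expands_at_damping c a0 v0 (lt_trans t0 tT) hT.
apply: (differentiable_expansion _ He); first by rewrite t0.
by have [] := is_derive_damping c a0 v0 t0 h.
Qed.

Let differentiable_forcing t k : 0 < t -> 0 < a * g t + k ->
  is_derive t 1 (fun x => \int[mu]_(y in `[0, x]) f y) (f t) ->
  differentiable (fun z : R * R => forcing z.1 z.2) (t, k).
Proof.
move=> t0 h df; have [T tT hT] := characteristic_dom_extend v0 t0 h.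
have [e' He] := expands_at_forcing (lt_trans t0 tT) hT.
apply: (differentiable_expansion _ He); first by rewrite t0.
by have [] := is_derive_forcing t0 h df.
Qed.

Let characteristic_dom0 t k : 0 < t -> 0 < a * g t + k -> 0 < a * g 0 + k.
Proof. by move=> t0; apply: characteristic_dom_le => //; exact: ltW. Qed.

Let differentiable_expR_comp (V : normedModType R) (h : V -> R) z :
  differentiable h z -> differentiable (fun y => expR (h y)) z.
Proof.
move=> dh; apply: (differentiable_comp dh).
by apply/derivable1_diffP; have [] := is_derive_expR (h z).
Qed.

Let differentiable_evolution t k : 0 < t -> 0 < a * g t + k ->
  is_derive t 1 (fun x => \int[mu]_(y in `[0, x]) f y) (f t) ->
  differentiable (fun z : R * R => evolution z.1 z.2) (t, k).
Proof.
move=> t0 h df.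
apply: differentiableM.
  apply: (@differentiable_expR_comp _ (fun z : R * R => - Phi z.1 z.2)).
  by apply: differentiableN; exact: differentiable_damping.
apply: differentiableD; last exact: differentiable_forcing.
have h0 := characteristic_dom0 t0 h.
apply: (@differentiable_comp _ _ _ _ (fun z : R * R => (a * g 0 + z.2)^-1) lap).
  apply: (@differentiableV _ _ (fun z : R * R => a * g 0 + z.2)); last by rewrite gt_eqF.
  apply: differentiableD; first exact: differentiable_cst.
  exact: differentiable_snd.
by apply/derivable1_diffP; apply: dlap; rewrite invr_gt0.
Qed.

Let differentiable_K t s : 0 < t -> 0 < s ->
  differentiable (fun z : R * R => Kts z.1 z.2) (t, s).
Proof.
move=> t0 s0.
pose Z z : R := expR (- (b * z)).
have dZ : differentiable Z t.
  by apply/derivable1_diffP; have [] := is_derive_expR_decay b t.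
have dg : differentiable g t.
  by apply/derivable1_diffP; have [] := is_derive_scaled_gamma b v0 t0.
have : differentiable (fun z : R * R => Z z.1 * z.2^-1 - a * g z.1) (t, s).
  apply: differentiableB.
    apply: differentiableM.
      by apply: (@differentiable_comp _ _ _ _ fst Z); [exact: differentiable_fst|].
    apply: (@differentiableV _ _ (snd : R * R -> R)); last by rewrite gt_eqF.
    exact: differentiable_snd.
  apply: differentiableM; first exact: differentiable_cst.
  by apply: (@differentiable_comp _ _ _ _ fst g); [exact: differentiable_fst|].
apply: near_eq_differentiable.
have c2 : z.2 @[z --> (t, s)] --> s by exact: cvg_snd.
near=> z; rewrite KE//; near: z; exact: (cvgr_gt s).
Unshelve. all: by end_near. Qed.

Let is_derive_evolution t k : 0 < t -> 0 < a * g t + k ->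
  is_derive t 1 (fun x => \int[mu]_(y in `[0, x]) f y) (f t) ->
  is_derive t 1 (evolution ^~ k) (- c * S t k * evolution t k + f t).
Proof.
move=> t0 h df.
have d1 : is_derive t 1 (fun x => expR (- Phi x k)) (expR (- Phi t k) * - (c * S t k)).
  apply: (@is_derive1_comp R expR (fun x => - Phi x k)).
  by apply: is_deriveN; exact: is_derive_damping.
have d2 : is_derive t 1 (cst (lap (a * g 0 + k)^-1) + forcing ^~ k)
    (0 + f t * expR (Phi t k)).
  by apply: is_deriveD; exact: is_derive_forcing.
have d3 : is_derive t 1 (evolution ^~ k) _ := is_deriveM d1 d2.
apply: (is_derive_eq d3).
rewrite /evolution !fctE /GRing.scale/= add0r.
rewrite mulrCA -expRD addNr expR0 mulr1; ring.
Qed.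

Let forcing_K_le M t s : 0 < s -> 0 < t -> (forall x, 0 <= x <= t -> `|f x| <= M) ->
  `|forcing t (Kts t s)| <= M * expR (`|c| * s * expR (`|b| * t) * t) * t.
Proof.
move=> s0 t0 fM.
have hK := K_in_dom a b v t s0.
rewrite -[X in _ <= _ * X]subr0; apply: norm_Rintegral_le; first exact: ltW.
  apply: bounded_mfunM => //; apply: continuous_bounded_mfun.
  exact: expR_damping_continuous.
move=> x xt; rewrite normrM ler_pM// ?fM//.
rewrite (ger0_norm (expR_ge0 _)) ler_expR (le_trans (ler_norm _))//.
by apply: damping_K_le => //; have /andP[] := xt.
Qed.

Let small_cvg s : `|c| * s * expR (`|b| * t) * t @[t --> 0^'+] --> (0 : R).
Proof.
apply: cvg_at_right_filter.
rewrite [X in _ --> X](_ : 0 = `|c| * s * expR (- (- `|b| * 0)) * 0); last by rewrite mulr0.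
under eq_fun do rewrite -[`|b| * _]opprK -mulNr.
apply: cvgM => //; apply: cvgM; first exact: cvg_cst.
exact: continuous_expR_decay.
Qed.

Let damping_K_cvg0 s : 0 < s -> Phi t (Kts t s) @[t --> 0^'+] --> (0 : R).
Proof.
move=> s0; apply: norm_cvg0.
apply: (@squeeze_cvgr _ _ _ _ (cst 0) _ _ _ _ _ (small_cvg s)); last exact: cvg_cst.
near=> t; have t0 : 0 < t by near: t; exact: nbhs_right_gt.
by rewrite normr_ge0/=; apply: damping_K_le => //; exact: ltW.
Unshelve. all: by end_near. Qed.

Let forcing_K_cvg0 s : 0 < s -> forcing t (Kts t s) @[t --> 0^'+] --> (0 : R).
Proof.
move=> s0; apply: norm_cvg0.
have [_ [M fM]] := bf 1.
have lim : M * expR (`|c| * s * expR (`|b| * t) * t) * t @[t --> 0^'+] --> (0 : R).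
  rewrite [X in _ --> X](_ : 0 = M * expR 0 * 0); last by rewrite mulr0.
  apply: cvgM; last by apply: cvg_at_right_filter; exact: cvg_id.
  apply: cvgM; first exact: cvg_cst.
  by apply: (cvg_comp _ _ (small_cvg s)); exact: continuous_expR.
apply: (@squeeze_cvgr _ _ _ _ (cst 0) _ _ _ _ _ lim); last exact: cvg_cst.
near=> t; have t0 : 0 < t by near: t; exact: nbhs_right_gt.
rewrite normr_ge0/=; apply: forcing_K_le => //.
move=> x /andP[x0 xt]; apply: fM; rewrite x0 (le_trans xt)//.
by near: t; exact: nbhs_right_le.
Unshelve. all: by end_near. Qed.

Let continuous_lap s : 0 < s -> {for s, continuous lap}.
Proof.
by move=> s0; apply: differentiable_continuous; apply/derivable1_diffP; exact: dlap.
Qed.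

Section formula.
Variable G : R -> R -> R.
Hypothesis hG : forall t s : R, 0 < t -> 0 < s ->
  is_antiderivative t (G_integrand a b c v (Kts t s)) (G ^~ (Kts t s)).
Notation omega := (omega_formula a b v lap f G).

(** Only differences of G occur in the formula, which makes the constants of
    integration, possibly different for each k, disappear. *)
Let damping_G t s x : 0 < t -> 0 < s -> 0 <= x -> x <= t ->
  Phi x (Kts t s) = G x (Kts t s) - G 0 (Kts t s).
Proof.
move=> t0 s0 x0 xt; have [cG dG] := hG t0 s0.
have sub : (`[0, x] : set R) `<=` `[0, t] by apply: subset_itvl; rewrite bnd_simp.
apply: (@Rintegral_FTC R (G ^~ (Kts t s))) => //.
- apply: continuous_subspaceW sub _; apply: continuous_G_integrand => //.
  exact: K_in_dom.
- exact: continuous_subspaceW sub cG.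
- by move=> y /andP[y0 yx]; apply: dG; rewrite y0 (lt_le_trans yx).
Qed.

Lemma omega_formulaE t s : 0 < t -> 0 < s -> omega t s = evolution t (Kts t s).
Proof.
move=> t0 s0; rewrite /omega_formula /evolution; set k := Kts t s.
have GE x : 0 <= x -> x <= t -> G x k = G 0 k + Phi x k.
  by move=> x0 xt; rewrite damping_G// addrC subrK.
have -> : \int[mu]_(x in `[0, t]) (f x * expR (G x k)) = expR (G 0 k) * forcing t k.
  rewrite -RintegralZl//=; last first.
    apply: bounded_mfun_integrable; apply: bounded_mfunM => //.
    apply: continuous_bounded_mfun; apply: expR_damping_continuous => //.
    exact: K_in_dom.
  apply: eq_Rintegral => x; rewrite inE/= in_itv/= => /andP[x0 xt].
  by rewrite GE// expRD; ring.
have -> : s * expR (b * t) / (1 - s * expR (b * t) * a * (g t - g 0)) = (a * g 0 + k)^-1.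
  have h : 0 < a * g 0 + k by apply: characteristic_dom0 t0 _; exact: K_in_dom.
  rewrite -[LHS]invrK invfM invrK; congr (_^-1).
  rewrite /k KE// expRN; field.
  by rewrite (gt_eqF s0) gt_eqF ?expR_gt0.
rewrite (GE t (ltW t0) (lexx _)) [RHS]mulrDr; congr (_ * _ + _).
  by congr expR; ring.
by rewrite mulrA -expRD; congr (expR _ * _); ring.
Qed.

(** By the chain rule along the characteristic through (t, s), the left-hand side
    of the equation is the derivative of evolution ^~ k with k = K(t, s) fixed. *)
Lemma omega_formula_solves_pde t s : 0 < t -> 0 < s ->
  is_derive t 1 (fun x => \int[mu]_(y in `[0, x]) f y) (f t) ->
  solves_pde_at a b c v f omega t s.
Proof.
move=> t0 s0 df; set k := Kts t s.
have h : 0 < a * g t + k by exact: K_in_dom.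
have dO : differentiable (fun z : R * R => omega z.1 z.2) (t, s).
  have : differentiable (fun z : R * R => evolution z.1 (Kts z.1 z.2)) (t, s).
    apply: (@differentiable_comp _ _ _ _ (fun z : R * R => (z.1, Kts z.1 z.2))
      (fun z : R * R => evolution z.1 z.2)).
      by apply: differentiable_pair; [exact: differentiable_fst|exact: differentiable_K].
    exact: differentiable_evolution.
  apply: near_eq_differentiable.
  have c1 : z.1 @[z --> (t, s)] --> t by exact: cvg_fst.
  have c2 : z.2 @[z --> (t, s)] --> s by exact: cvg_snd.
  near=> z; rewrite omega_formulaE//; near: z; [exact: (cvgr_gt t)|exact: (cvgr_gt s)].
split => //.
have St : S t k = s by exact: characteristic_K.
have dS := is_derive_characteristic v0 t0 h; rewrite St in dS.
have [_ d1] := is_derive_along dO St dS.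
have [T tT hT] := characteristic_dom_extend v0 t0 h.
have dE := is_derive_evolution t0 h df.
have : is_derive t 1 (fun x => omega x (S x k)) (- c * S t k * evolution t k + f t).
  apply: near_eq_is_derive dE => //.
  near=> x.
  have x0 : 0 < x by near: x; exact: lt_nbhsr.
  have xT : x <= T by apply/ltW; near: x; exact: lt_nbhsl.
  have hx : 0 < a * g x + k by apply: characteristic_dom_le xT hT => //; exact: ltW.
  have E := omega_formulaE x0 (characteristic_gt0 hx).
  rewrite (K_characteristic hx) in E.
  exact: esym E.
move=> [_ d2].
rewrite St -omega_formulaE// in d2.
by rewrite -d2 d1.
Unshelve. all: by end_near. Qed.

Lemma omega_formula_initial : initial_condition lap omega.
Proof.
move=> s s0.
have k_cvg := @K_cvg0 R a b v v0 s s0.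
have inv_cvg : (a * g 0 + Kts t s)^-1 @[t --> 0^'+] --> s.
  rewrite -[X in _ --> X]invrK; apply: cvgV; first by rewrite invr_eq0 gt_eqF.
  rewrite [X in _ --> X](_ : _ = a * g 0 + (s^-1 - a * g 0)); last by rewrite addrC subrK.
  by apply: cvgD; [exact: cvg_cst|].
have : evolution t (Kts t s) @[t --> 0^'+] --> expR (- 0) * (lap s + 0).
  apply: cvgM.
    apply: (@cvg_comp _ _ _ (fun t => - Phi t (Kts t s)) expR _ (nbhs (- 0))).
      by apply: cvgN; exact: damping_K_cvg0.
    exact: continuous_expR.
  apply: cvgD; last exact: forcing_K_cvg0.
  by apply: (cvg_comp _ _ inv_cvg); exact: continuous_lap.
rewrite oppr0 expR0 mul1r addr0; apply: cvg_trans; apply: near_eq_cvg.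
by near=> t; rewrite omega_formulaE.
Unshelve. all: by end_near. Qed.

End formula.

Section uniqueness.
Variable w : R -> R -> R.
Hypothesis wP : is_solution a b c v lap f w.

(** Up to the contribution of the source, the quantity that a solution carries
    unchanged along a characteristic. *)
Let A t k := expR (Phi t k) * w t (S t k).

Let is_derive_carried t k : 0 < t -> 0 < a * g t + k ->
  is_derive t 1 (A ^~ k) (f t * expR (Phi t k)).
Proof.
move=> t0 h; have S0 := characteristic_gt0 h.
have [dw pde] := wP.1 t (S t k) t0 S0.
have d1 := is_derive_along dw erefl (is_derive_characteristic v0 t0 h).
have d2 : is_derive t 1 (fun x => expR (Phi x k)) (expR (Phi t k) * (c * S t k)).
  apply: (@is_derive1_comp R expR (fun x => Phi x k)).
  exact: is_derive_damping.
have d3 : is_derive t 1 (A ^~ k) _ := is_deriveM d2 d1.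
apply: (is_derive_eq d3).
rewrite /GRing.scale/= pde; ring.
Qed.

Let forcing_diff x y k : 0 < x -> x <= y -> 0 < a * g y + k ->
  forcing y k - forcing x k = A y k - A x k.
Proof.
move=> x0 xy hy; have y0 := lt_le_trans x0 xy.
have [T yT hT] := characteristic_dom_extend v0 y0 hy.
have T0 := lt_trans y0 yT.
have bfe : bounded_mfun 0 T (fun z => f z * expR (Phi z k)).
  apply: bounded_mfunM => //; apply: continuous_bounded_mfun.
  exact: expR_damping_continuous.
have [_ [M fM]] := bfe.
rewrite /forcing (Rintegral_split (ltW x0) xy); last first.
  by apply: bounded_mfunS bfe => //; exact: ltW.
rewrite addrC addKr.
apply: (@FTC_bounded_derivative R (A ^~ k) (fun z => f z * expR (Phi z k))
  (x / 2) T x y M) => //.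
- by rewrite ltr_pdivrMr// ltr_pMr// ltr1n.
- move=> z /andP[xz zT]; have z0 : 0 < z by apply: lt_trans xz; rewrite divr_gt0.
  by apply: is_derive_carried => //; apply: characteristic_dom_le hT => //; exact: ltW.
- move=> z /andP[xz zT]; apply: fM; rewrite (ltW zT) andbT.
  by apply: ltW; apply: lt_trans xz; rewrite divr_gt0.
Qed.

Let carried_sub_forcing x y k : 0 < x -> 0 < y -> 0 < a * g x + k -> 0 < a * g y + k ->
  A x k - forcing x k = A y k - forcing y k.
Proof.
move=> x0 y0 hx hy; have [xy|yx] := leP x y.
  by have := forcing_diff x0 xy hy; lra.
by have := forcing_diff y0 (ltW yx) hx; lra.
Qed.

(** Continuity in the parameter comes from a positive time, where the solution is
    differentiable. *)
Let carried_sub_forcing_cvg t k : 0 < t -> 0 < a * g t + k ->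
  A t k' - forcing t k' @[k' --> k] --> A t k - forcing t k.
Proof.
move=> t0 h.
have [e1 H1] := expands_at_damping c a0 v0 t0 h.
have [e2 H2] := expands_at_forcing t0 h.
have tt : 0 <= t <= t by rewrite lexx ltW.
apply: cvgB; last exact: (expands_at_cvg tt H2).
apply: cvgM.
  by apply: (cvg_comp _ _ (expands_at_cvg tt H1)); exact: continuous_expR.
have cS : S t k' @[k' --> k] --> S t k.
  apply: cvgM; first exact: cvg_cst.
  apply: cvgV; first by rewrite gt_eqF.
  by apply: cvgD; [exact: cvg_cst|exact: cvg_id].
have [dw _] := wP.1 t (S t k) t0 (characteristic_gt0 h).
have cw := differentiable_continuous dw.
have cp : (t, S t k') @[k' --> k] --> (t, S t k).
  apply: (@cvg_pair _ _ _ (nbhs k) (nbhs t) (nbhs (S t k)) _ _ _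
    (fun=> t) (fun k' => S t k')); first exact: cvg_cst.
  exact: cS.
exact: (cvg_comp _ _ cp cw).
Qed.

(** On the vertical line s = 1 / (a g(0) + k) the parameters K(x, s) converge to k
    as x -> 0, while e^Phi tends to 1 and Psi to 0 there. So w(x, s) tends to the
    value carried by the characteristic k, and to lap s by the initial condition. *)
Let lap_carried t k : 0 < t -> 0 < a * g t + k ->
  lap (a * g 0 + k)^-1 = A t k - forcing t k.
Proof.
move=> t0 h; have h0 := characteristic_dom0 t0 h.
pose s := (a * g 0 + k)^-1.
have s0 : 0 < s by rewrite invr_gt0.
have k_cvg := @K_cvg0 R a b v v0 s s0.
rewrite (_ : s^-1 - a * g 0 = k) in k_cvg; last by rewrite invrK addrAC subrr add0r.
have lim1 : w x s @[x --> 0^'+] --> lap s by exact: wP.2.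
have lim2 : w x s @[x --> 0^'+] --> expR (- 0) * ((A t k - forcing t k) + 0).
  have : expR (- Phi x (Kts x s)) * ((A t (Kts x s) - forcing t (Kts x s))
      + forcing x (Kts x s)) @[x --> 0^'+] --> expR (- 0) * ((A t k - forcing t k) + 0).
    apply: cvgM.
      apply: (@cvg_comp _ _ _ (fun x => - Phi x (Kts x s)) expR _ (nbhs (- 0))).
        by apply: cvgN; exact: damping_K_cvg0.
      exact: continuous_expR.
    apply: cvgD; last exact: forcing_K_cvg0.
    exact: (cvg_comp _ _ k_cvg (carried_sub_forcing_cvg t0 h)).
  apply: cvg_trans; apply: near_eq_cvg.
  have c1 : a * g t + Kts x s @[x --> 0^'+] --> a * g t + k.
    by apply: cvgD; [exact: cvg_cst|].
  near=> x.
  have x0 : 0 < x by near: x; exact: nbhs_right_gt.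
  have ht : 0 < a * g t + Kts x s by near: x; exact: (cvgr_gt _ c1).
  have hx := K_in_dom a b v x s0.
  rewrite (carried_sub_forcing t0 x0 ht hx) subrK /A characteristic_K//.
  by rewrite mulrA -expRD addNr expR0 mul1r.
rewrite oppr0 expR0 mul1r addr0 in lim2.
exact: cvg_unique lim1 lim2.
Unshelve. all: by end_near. Qed.

Lemma solution_eq_evolution t s : 0 < t -> 0 < s -> w t s = evolution t (Kts t s).
Proof.
move=> t0 s0; have h := K_in_dom a b v t s0.
rewrite /evolution (lap_carried t0 h) subrK /A characteristic_K//.
by rewrite mulrA -expRD addNr expR0 mul1r.
Qed.

End uniqueness.

End solution.

(** * Measurability of the source of a solution *)
Section source_of_solution.
Context {R : realType}.
Implicit Types (f : R -> R) (w : R -> R -> R).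

Let slope_sequence (h : R -> R) (x : R) : derivable h x 1 ->
  n.+1%:R * (h (n.+1%:R^-1 + x) - h x) @[n --> \oo] --> derive1 h x.
Proof.
move=> dh.
have dh1 : is_derive x 1 h (derive1 h x) by apply: DeriveDef; rewrite ?derive1E.
have harm : (forall n : nat, n.+1%:R^-1 != 0 :> R) /\ n.+1%:R^-1 @[n --> \oo] --> (0 : R).
  by split; [move=> n; rewrite invr_eq0|exact: cvg_harmonic].
have /cvgr_dnbhsP/(_ _ harm) := slope_is_derive dh1.
by under eq_fun do rewrite invrK.
Qed.

(** The equation on the line s = 1 expresses f through w and its partial
    derivatives, which are limits of difference quotients of functions continuous
    in t. *)
Lemma solution_source_measurable (a b c v : R) f w :
  (forall t s : R, 0 < t -> 0 < s -> solves_pde_at a b c v f w t s) ->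
  measurable_fun (`]0, +oo[ : set R) f.
Proof.
move=> wP.
have dpair t s : 0 < t -> 0 < s ->
    derivable (w ^~ s) t 1 /\ derivable (w t) s 1.
  move=> t0 s0; have [dw _] := wP t s t0 s0.
  have d1 : differentiable (fun x : R => (x, cst s x)) t by exact: differentiable_pair.
  have d2 : differentiable (fun x : R => (cst t x, x)) s by exact: differentiable_pair.
  split; apply/derivable1_diffP.
    exact: (@differentiable_comp _ _ _ _ _ (fun z : R * R => w z.1 z.2) _ d1 dw).
  exact: (@differentiable_comp _ _ _ _ _ (fun z : R * R => w z.1 z.2) _ d2 dw).
have mw s : 0 < s -> measurable_fun (`]0, +oo[ : set R) (w ^~ s).
  move=> s0; apply: open_continuous_measurable_fun => // t.
  rewrite inE/= in_itv/= andbT => t0.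
  apply: differentiable_continuous; apply/derivable1_diffP.
  exact: (dpair t s t0 s0).1.
have mwn (n : nat) : measurable_fun (`]0, +oo[ : set R) (fun t => w (n.+1%:R^-1 + t) 1).
  apply: open_continuous_measurable_fun => // t.
  rewrite inE/= in_itv/= andbT => t0.
  apply: (@continuous_comp R R R (fun t : R => n.+1%:R^-1 + t) (w ^~ 1) t).
    by apply: cvgD; [exact: cvg_cst|exact: cvg_id].
  apply: differentiable_continuous; apply/derivable1_diffP.
  by apply: (dpair _ _ _ ltr01).1; rewrite addr_gt0// invr_gt0.
pose h (n : nat) t := n.+1%:R * (w (n.+1%:R^-1 + t) 1 - w t 1)
  + (a * t `^ (2 * v - 1) - b) * (n.+1%:R * (w t (n.+1%:R^-1 + 1) - w t 1)) + c * w t 1.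
apply: (@measurable_fun_cvg _ _ R _ h) => [n|t].
  apply: measurable_funD; last first.
    by apply: measurable_funM => //; exact: mw.
  apply: measurable_funD.
    by apply: measurable_funM => //; apply: measurable_funB => //; exact: mw.
  apply: measurable_funM.
    apply: measurable_funB => //; apply: measurable_funM => //.
    by apply: measurable_funTS; exact: measurable_powR.
  apply: measurable_funM => //; apply: measurable_funB; first by apply: mw; rewrite addr_gt0.
  exact: mw.
rewrite /= in_itv/= andbT => t0.
have [_ pde] := wP t 1 t0 ltr01.
have -> : f t = derive1 (w ^~ 1) t + (a * t `^ (2 * v - 1) - b) * derive1 (w t) 1 + c * w t 1.
  by rewrite mulr1 mul1r in pde; rewrite pde; ring.
have [d1 d2] := dpair t 1 t0 ltr01.
apply: cvgD; last exact: cvg_cst.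
apply: cvgD; first exact: slope_sequence d1.
by apply: cvgM; [exact: cvg_cst|exact: slope_sequence d2].
Qed.

End source_of_solution.

Theorem lemma4p1 (R : realType) (a b c v : R) (P lap f : R -> R)
    (G : R -> R -> R)
    (ha : 0 < a) (hv : 0 < v)
    (hPbv : forall x y : R, 0 < x -> x < y -> bounded_variation x y P)
    (hP0 : P x @[x --> 0^'+] --> (0 : R))
    (hlap : forall s : R, 0 < s -> is_laplace_stieltjes P s (lap s))
    (hf : locally_bounded f)
    (hG : forall t s : R, 0 < t -> 0 < s ->
       is_antiderivative t (G_integrand a b c v (K a b v t s))
         (G ^~ (K a b v t s))) :
  [/\ forall omega : R -> R -> R, is_solution a b c v lap f omega ->
        forall t s : R, 0 < t -> 0 < s ->
          omega t s = omega_formula a b v lap f G t s,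
      {in `]0, +oo[, continuous f} ->
        is_solution a b c v lap f (omega_formula a b v lap f G) &
      measurable_fun (`]0, +oo[ : set R) f ->
        is_solution_ae a b c v lap f (omega_formula a b v lap f G)].
Proof.
have dlap s : 0 < s -> derivable lap s 1 by exact: laplace_derivable hPbv hP0 hlap _.
split.
- move=> omega om t s t0 s0; have mf := solution_source_measurable om.1.
  rewrite (solution_eq_evolution ha hv mf hf om t0 s0).
  by rewrite (omega_formulaE lap ha hv mf hf hG t0 s0).
- move=> cf.
  have mf : measurable_fun (`]0, +oo[ : set R) f.
    by apply: open_continuous_measurable_fun => // t; rewrite inE/= => /cf.
  split; last exact: (omega_formula_initial ha hv dlap mf hf hG).
  move=> t s t0 s0; apply: (omega_formula_solves_pde ha hv dlap mf hf hG t0 s0).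
  exact: is_derive_Rintegral_source.
- move=> mf; split; last exact: (omega_formula_initial ha hv dlap mf hf hG).
  have := ae_is_derive_Rintegral mf hf.
  apply: filterS; first exact: (ae_filter_ringOfSetsType lebesgue_measure).
  move=> t df t0 s s0.
  exact: (omega_formula_solves_pde ha hv dlap mf hf hG t0 s0 (df t0)).
Qed.
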